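(* Consider the constrained linear network, the local optimal control problems $\mathrm{OCP}_i(t)$ and the closed loop described in the context, with $x(0)\in\mathcal X$. Suppose: (L1) $P_i\succ0$, a block-diagonal $K$, an integer $M\ge2$ and gains $a_{ij}\ge0$ satisfy either the gain-allocation condition (GA) or, for every $i$, the SDP certificate (SDP) of the context, and $p_i>0$, $\theta\in(0,1)$ satisfy $a_{ij}p_j\le\theta p_i$ whenever $a_{ij}>0$; (L2) the finite-step feedback $q(\xi)=(K\xi,KA_K\xi,\dots,KA_K^{M-1}\xi)$ is admissible on the domain on which the finite-step small-gain assumption is considered (see context); (L3) the problems $\mathrm{OCP}_i(0)$ are feasible, and at every transition $t\to t+1$, for every $i$, both of the following hold: for every row $k$ and every $l=1,\dots,M-1$, $$F_{i,k}x_i^{\mathrm{nom},\star}(l+1|t)+\|F_{i,k}\|_2\bigl(\chi_i(l|t+1)+\tilde r_i(l|t+1)\bigr)\le f_{i,k},$$ and there exists $v_i$ with $G_iv_i\le g_i$ and $\|P_i^{1/2}(a_i+B_iv_i)\|_2\le\sqrt{b_i}$, where $a_i=A_{ii}\tilde x_i^{\mathrm{nom}}(M-1|t+1)+\sum_{j\in\mathcal N_i}A_{ij}\bar x_j(M-1|t+1)$ and $b_i=\max_j a_{ij}W_j(x_j(t+1))$. Let $V(x)=\max_i x_i^\top P_ix_i/p_i$ and $\rho(t)=\max_i(r_i^\star(M|t)+s_i(M|t))$. Choose $\nu_M>0$ with $a_L:=(1+\nu_M)\theta<1$ and put $b_L:=(1+\nu_M^{-1})c_P$. Then: (a) the problems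 $\mathrm{OCP}_i(t)$ are feasible for all $t$ and all $i$, and $x(t)\in\mathcal X$, $u(t)\in\mathcal U$ for all $t\in\mathbb Z_{\ge0}$; (b) $V(x(t+r))\le\kappa_LV(x(t))+\Delta_L(t)$ for all $t\in\mathbb Z_{\ge0}$, $r=0,\dots,M-1$; (c) $V(x(t+M))\le a_LV(x(t))+b_L\rho(t)^2$ for all $t\in\mathbb Z_{\ge0}$; (d) for every $r\in\{0,\dots,M-1\}$ and $k\in\mathbb Z_{\ge0}$, $$V(x(r+kM))\le a_L^k\bigl(\kappa_LV(x(0))+\Delta_L(0)\bigr)+b_L\sum_{q=0}^{k-1}a_L^{k-1-q}\rho(r+qM)^2,$$ the sum being zero for $k=0$; (e) if $\rho(t)\le\bar\rho$ for all $t$, then $\limsup_{t\to\infty}V(x(t))\le\frac{b_L}{1-a_L}\bar\rho^2$ and $\limsup_{t\to\infty}\|x(t)\|_2\le\sqrt{\frac{b_L}{c_V(1-a_L)}}\,\bar\rho$; (f) if $\rho(t)\to0$, then $x(t)\to0$; (g) if $\rho(t)=0$ for all $t$ and, on the considered domain of initial states, there is a constant $d_\Delta\ge0$ with $\Delta_L(0)\le d_\Delta V(x(0))$, then the origin is asymptotically stable on that domain; more precisely $V(x(r+kM))\le a_L^k(\kappa_L+d_\Delta)V(x(0))$ for $r=0,\dots,M-1$, $k\in\mathbb Z_{\ge0}$, which yields an estimate $\|x(t)\|_2\le\beta(\|x(0)\|_2,t)$ with some $\beta\in\mathcal{KL}$.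
   Context: Notation. $\|\cdot\|=\|\cdot\|_2$ Euclidean (induced matrix) norm, $\mathbb B_\Delta$ the closed ball of radius $\Delta$ at $0$, $\mathcal S\ominus\mathcal E=\{z:z+e\in\mathcal S\ \forall e\in\mathcal E\}$; maxima over empty sets are $0$; $\|v_{\mathcal N_i}\|_{\mathcal N_i,\infty}=\max_{j\in\mathcal N_i}\|v_j\|$; $P^{1/2}$ is the principal square root and $P^{-1/2}$ its inverse. $\mathcal{KL}$: functions $\beta(s,t)$ continuous, strictly increasing and zero at zero in $s$, decreasing to $0$ in $t$. Network. $x(t+1)=Ax(t)+Bu(t)$, $x=(x_1,\dots,x_\ell)$, $u=(u_1,\dots,u_\ell)$, $A=[A_{ij}]$, $B=\operatorname{blkdiag}(B_1,\dots,B_\ell)$; locally $x_i^+=A_{ii}x_i+\sum_{j\in\mathcal N_i}A_{ij}x_j+B_iu_i$. Constraints $\mathcal X_i=\{x_i:F_ix_i\le f_i\}$ (nonempty, rows $F_{i,k}\ne0$), $\mathcal U_i=\{u_i:G_iu_i\le g_i\}$, $\mathcal X=\prod_i\mathcal X_i$, $\mathcal U=\prod_i\mathcal U_i$. $L_{i,1}=\|A_{ii}\|_2$, $L_{i,2}=\sum_{j\in\mathcal N_i}\|A_{ij}\|_2$, $L_{i,3}=\|B_i\|_2$. $K=\operatorname{blkdiag}(K_1,\dots,K_\ell)$, $A_K=A+BK$, $A_K^M=[\Phi_{ij}(M)]$. $W_i(x_i)=x_i^\top P_ix_i$, $\gamma_{ij}(s)=a_{ij}s$, and $a_{ij}=0$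 when $\Phi_{ij}(M)=0$, $a_{ij}>0$ otherwise. (GA): with $c_{ij}=\|P_i^{1/2}\Phi_{ij}(M)P_j^{-1/2}\|_2$, $\sum_{j:c_{ij}>0}c_{ij}/\sqrt{a_{ij}}\le1$ for every $i$. (SDP) for $i$: with $\Phi_i(M)=[\Phi_{i1}(M)\cdots\Phi_{i\ell}(M)]$ there are $\tau_{ij}\ge0$ with $\Phi_i(M)^\top P_i\Phi_i(M)\preceq\operatorname{blkdiag}(\tau_{i1}P_1,\dots,\tau_{i\ell}P_\ell)$ and $\sum_{j:\Phi_{ij}(M)\ne0}\tau_{ij}/a_{ij}\le1$. Admissibility in (L2): on the domain $\mathcal D_0\subseteq\mathcal X$ considered for the small-gain assumption, for $\xi\in\mathcal D_0$, $KA_K^r\xi\in\mathcal U$ for $r=0,\dots,M-1$, $A_K^r\xi\in\mathcal X$ for $r=1,\dots,M$ (and $\|A_K^r\xi\|$ is bounded by a class-$\mathcal K$ function of $\|\xi\|$). The small-gain assumption is: $W_i((A_K^M\xi)_i)\le\max_j\gamma_{ij}(W_j(\xi_j))$ for all $\xi\in\mathcal D_0$, all $i$, and every product of the $a_{ij}$ along a simple directed cycle is $<1$. Packets. At time $t$ subsystem $i$ sends $(\bar x_i(l|t),\bar r_i(l|t))_{l=0}^{M-1}$ to the controllers of which it is a neighbor: $\bar x_i(0|t)=x_i(t)$, $\bar r_i(0|t)=0$; for $t\ge1$, $l=1,\dots,M-1$: $\bar x_i(l|t)=x_i^{\mathrm{nom},\star}(l+1|t-1)$, $\bar r_i(l|t)=r_i^\star(l+1|t-1)$;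 at $t=0$ they are supplied by initialization (nonnegative radii). Controller $i$ knows the packets of all $j\in\mathcal N_i$ and $W_j(x_j(t))$ for all $j$ with $a_{ij}>0$. Budget. $\mathcal B_i(l|t)=L_{i,2}\max_{j\in\mathcal N_i}\bar r_j(l|t)+d_i(l|t)$; $d_i(l|t)=L_{i,2}\max_{j\in\mathcal N_i}\|\bar x_j(l|t)-\bar x_j(l+1|t-1)\|$ for $l\le M-2$ (nonnegative initialization values for $t=0$), $d_i(M-1|t)=d_i^{\mathrm{ter}}(t)\ge0$ prescribed. $\mathrm{OCP}_i(t)$ (with $\lambda>0$): minimize over $(u_i(l|t))_{l=0}^{M-1}$, $(r_i(l|t))_{l=1}^{M-1}$ the cost $\sum_{l=0}^{M-1}W_i(x_i^{\mathrm{nom}}(l|t))+\lambda\sum_{l=1}^{M-1}r_i(l|t)$ subject to $x_i^{\mathrm{nom}}(0|t)=x_i(t)$; $x_i^{\mathrm{nom}}(l+1|t)=A_{ii}x_i^{\mathrm{nom}}(l|t)+\sum_{j\in\mathcal N_i}A_{ij}\bar x_j(l|t)+B_iu_i(l|t)$, $u_i(l|t)\in\mathcal U_i$, $l=0,\dots,M-1$; $r_i(l|t)\ge0$, $x_i^{\mathrm{nom}}(l|t)\in\mathcal X_i\ominus\mathbb B_{r_i(l|t)}$, $l=1,\dots,M-1$; $r_i(l+1|t)\ge L_{i,1}r_i(l|t)+\mathcal B_i(l|t)$, $l=0,\dots,M-2$, with $r_i(0|t):=0$; $W_i(x_i^{\mathrm{nom}}(M|t))\le\max_ja_{ij}W_j(x_j(t))$.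 Optimal value $J_i^\star(t)$; optimizers carry a star (existence understood when feasible); $r_i^\star(0|t)=0$, $r_i^\star(M|t):=L_{i,1}r_i^\star(M-1|t)+\mathcal B_i(M-1|t)$. The closed loop applies $u_i(t)=u_i^\star(0|t)$. Shifted candidate at $t+1$ (for $l=0,\dots,M-2$): $\tilde x_i^{\mathrm{nom}}(0|t+1)=x_i(t+1)$, $\tilde x_i^{\mathrm{nom}}(l+1|t+1)=A_{ii}\tilde x_i^{\mathrm{nom}}(l|t+1)+\sum_{j\in\mathcal N_i}A_{ij}\bar x_j(l|t+1)+B_iu_i^\star(l+1|t)$; $\tilde r_i(0|t+1)=0$, $\tilde r_i(l+1|t+1)=L_{i,1}\tilde r_i(l|t+1)+\mathcal B_i(l|t+1)$; $\chi_i(0|t+1)=0$, $\chi_i(l+1|t+1)=L_{i,1}\chi_i(l|t+1)+L_{i,2}\|\bar x_{\mathcal N_i}(l|t+1)-\bar x_{\mathcal N_i}(l+1|t)\|_{\mathcal N_i,\infty}$. Mismatch. For $l=0,\dots,M-1$: $p_i(l|t)=\|x_{\mathcal N_i}(t+l)-\bar x_{\mathcal N_i}(l|t)\|_{\mathcal N_i,\infty}$, $\delta_i^u(l|t)=\|u_i^\star(0|t+l)-u_i^\star(l|t)\|$, $\eta_i(l|t)=\max\{L_{i,2}p_i(l|t)+L_{i,3}\delta_i^u(l|t)-\mathcal B_i(l|t),0\}$; $s_i(0|t)=0$, $s_i(l+1|t)=L_{i,1}s_i(l|t)+\eta_i(l|t)$. Constants. $c_P=\max_i\lambda_{\max}(P_i)/p_i$,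 $c_V=\frac1\ell\min_i\lambda_{\min}(P_i)/p_i$; $E_i$ is the block selector $x_i=E_ix$; $c_{q,i}=\sum_{l=0}^{M-1}\|P_i^{1/2}E_iA_K^l\|_2^2$, $c_q=\max_ic_{q,i}/p_i$; $\delta_J^L(t)=\max_i\frac1{p_i}\max\{J_i^\star(t)-c_{q,i}\|x(t)\|_2^2,0\}$; $\varepsilon_L(t)=\max_{r=0,\dots,M-1}\max_i(r_i^\star(r|t)+s_i(r|t))$; for a fixed $\nu_{\rm int}>0$, $\kappa_L=(1+\nu_{\rm int})c_q/c_V$, $\Delta_L(t)=(1+\nu_{\rm int})\delta_J^L(t)+(1+\nu_{\rm int}^{-1})c_P\varepsilon_L(t)^2$. *)

(* Defs.v *)
From HB Require Import structures.
From mathcomp Require Import all_boot all_order all_algebra.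
From mathcomp Require Import all_classical all_reals all_analysis.

Set Implicit Arguments.
Unset Strict Implicit.
Unset Printing Implicit Defensive.

Import Order.TTheory GRing.Theory Num.Theory.
Import numFieldNormedType.Exports.

Local Open Scope classical_set_scope.
Local Open Scope ring_scope.

(* Maximum of a finite family of nonnegative reals; 0 for an empty family. *)
Notation "\rmax_ ( i | P ) E" := (\big[Num.max/0%R]_(i | P) E%R)
  (at level 36, E at level 36, i at level 50,
   format "'[' \rmax_ ( i  |  P ) '/  '  E ']'") : ring_scope.
Notation "\rmax_ i E" := (\big[Num.max/0%R]_i E%R)
  (at level 36, E at level 36, i at level 0,
   format "'[' \rmax_ i '/  '  E ']'") : ring_scope.
Notation "\rmax_ ( i < n ) E" := (\big[Num.max/0%R]_(i < n) E%R)
  (at level 36, E at level 36, i, n at level 50,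
   format "'[' \rmax_ ( i  <  n ) '/  '  E ']'") : ring_scope.

Section Matrices.
Variable R : realType.

Definition enorm n (v : 'cV[R]_n) : R := Num.sqrt (\sum_i v i 0 ^+ 2).

Definition opnorm m n (A : 'M[R]_(m, n)) : R :=
  sup [set enorm (A *m v) | v in [set v : 'cV[R]_n | enorm v <= 1]].

Definition qform n (P : 'M[R]_n) (v : 'cV[R]_n) : R := (v^T *m P *m v) 0 0.

Definition posdef n (P : 'M[R]_n) : Prop :=
  P^T = P /\ forall v, v != 0 -> 0 < qform P v.

Definition possemidef n (P : 'M[R]_n) : Prop :=
  P^T = P /\ forall v, 0 <= qform P v.

Definition loewner_le n (X Y : 'M[R]_n) : Prop := possemidef (Y - X).

(* The principal square root: the unique positive semidefinite Q with Q^2 = P,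
   when P is positive semidefinite (0 if there is no such Q). *)
Definition sqrtmx n (P : 'M[R]_n) : 'M[R]_n :=
  xget 0 [set Q | possemidef Q /\ Q *m Q = P].

Definition lambda_max n (P : 'M[R]_n) : R := sup [set c | eigenvalue P c].
Definition lambda_min n (P : 'M[R]_n) : R := inf [set c | eigenvalue P c].

(* \mxdiag only covers square blocks; here the blocks are rectangular.
   [conform_mx 0 (B i)] is [B i] transported along i = j. *)
Definition blkdiag l (p q : 'I_l -> nat) (B : forall i, 'M[R]_(p i, q i)) :
    'M[R]_(\sum_i p i, \sum_i q i) :=
  \mxblock_(i, j) (if i == j then conform_mx 0 (B i) else (0 : 'M[R]_(p i, q j))).

Definition polyhedron m n (F : 'M[R]_(m, n)) (f : 'cV[R]_m) : set 'cV[R]_n :=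
  [set x | forall k, (F *m x) k 0 <= f k 0].

Definition cball n (d : R) : set 'cV[R]_n := [set e | enorm e <= d].

Definition pdiff n (S E : set 'cV[R]_n) : set 'cV[R]_n :=
  [set z | forall e, E e -> S (z + e)].

End Matrices.

Section Comparison.
Variable R : realType.

Definition class_K (al : R -> R) : Prop :=
  [/\ {within [set s : R | 0 <= s], continuous al}, al 0 = 0 &
      forall s s', 0 <= s -> s < s' -> al s < al s'].

(* Continuity is joint in (s, t); "decreasing in t" is nonincreasing, since
   be 0 t = 0 for every t. *)
Definition class_KL (be : R -> R -> R) : Prop :=
  [/\ {within [set z : R * R | 0 <= z.1 /\ 0 <= z.2],
         continuous (fun z : R * R => be z.1 z.2)},
      (forall t, 0 <= t -> be 0 t = 0),
      (forall t, 0 <= t -> forall s s', 0 <= s -> s < s' -> be s t < be s' t),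
      (forall s, 0 <= s -> forall t t', 0 <= t -> t <= t' -> be s t' <= be s t) &
      (forall s, 0 <= s -> be s t @[t --> +oo] --> (0 : R))].

Definition asymptotically_stable n (T : Type) (C : set T)
    (x : T -> nat -> 'cV[R]_n) : Prop :=
  (forall eps : R, 0 < eps -> exists2 del : R, 0 < del &
     forall z, C z -> enorm (x z 0%N) < del -> forall t, enorm (x z t) < eps) /\
  (forall z, C z -> enorm (x z t) @[t --> \oo] --> (0 : R)).

End Comparison.

Record network (R : realType) := Network {
  nsub : nat;
  xdim : 'I_nsub -> nat;
  udim : 'I_nsub -> nat;
  Amx : 'M[R]_(\sum_i xdim i);
  Bloc : forall i, 'M[R]_(xdim i, udim i);
  nbr : 'I_nsub -> {set 'I_nsub};
  xrows : 'I_nsub -> nat;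
  Fmx : forall i, 'M[R]_(xrows i, xdim i);
  fvec : forall i, 'cV[R]_(xrows i);
  urows : 'I_nsub -> nat;
  Gmx : forall i, 'M[R]_(urows i, udim i);
  gvec : forall i, 'cV[R]_(urows i);
  nsub_gt0 : (0 < nsub)%N;
  xdim_gt0 : forall i, (0 < xdim i)%N;
  nbr_irr : forall i, i \notin nbr i;
  nbr_coupling : forall i j, j != i -> j \notin nbr i -> submxblock Amx i j = 0;
  Xloc_neq0 : forall i, polyhedron (Fmx i) (fvec i) !=set0;
  Frow_neq0 : forall i k, row k (Fmx i) != 0
}.

Record design (R : realType) (S : network R) := Design {
  Kloc : forall i : 'I_(nsub S), 'M[R]_(udim i, xdim i);
  Pmx : forall i : 'I_(nsub S), 'M[R]_(xdim i);
  wgt : 'I_(nsub S) -> R;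
  gain : 'I_(nsub S) -> 'I_(nsub S) -> R;
  hor : nat;
  lam : R
}.

Section Network.
Variables (R : realType) (S : network R).
Notation I := 'I_(nsub S).

Definition state := 'cV[R]_(\sum_(i : I) xdim i).
Definition input := 'cV[R]_(\sum_(i : I) udim i).

Definition sub (x : state) (i : I) : 'cV[R]_(xdim i) := submxcol x i.
Definition subu (u : input) (i : I) : 'cV[R]_(udim i) := submxcol u i.

Definition Ablk (i j : I) : 'M[R]_(xdim i, xdim j) := submxblock (Amx S) i j.
Definition Bmx : 'M[R]_(\sum_(i : I) xdim i, \sum_(i : I) udim i) :=
  blkdiag (@Bloc R S).

Definition Xloc (i : I) : set 'cV[R]_(xdim i) := polyhedron (Fmx i) (fvec i).
Definition Uloc (i : I) : set 'cV[R]_(udim i) := polyhedron (Gmx i) (gvec i).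
Definition Xset : set state := [set x | forall i, Xloc (sub x i)].
Definition Uset : set input := [set u | forall i, Uloc (subu u i)].

Definition Lip1 (i : I) : R := opnorm (Ablk i i).
Definition Lip2 (i : I) : R := \sum_(j in nbr i) opnorm (Ablk i j).
Definition Lip3 (i : I) : R := opnorm (Bloc i).

(* \| v_{N_i} \|_{N_i, oo} *)
Definition nbrnorm (i : I) (v : forall j : I, 'cV[R]_(xdim j)) : R :=
  \rmax_(j | j \in nbr i) enorm (v j).

(* The selector E_i, i.e. sub x i = E_i x. *)
Definition Esel (i : I) : 'M[R]_(xdim i, \sum_(j : I) xdim j) := submxcol 1%:M i.

Definition locstep (i : I) (xi : 'cV[R]_(xdim i))
    (y : forall j : I, 'cV[R]_(xdim j)) : 'cV[R]_(xdim i) :=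
  Ablk i i *m xi + \sum_(j in nbr i) Ablk i j *m y j.

Fixpoint nomtraj (i : I) (x0 : 'cV[R]_(xdim i))
    (y : forall j : I, nat -> 'cV[R]_(xdim j))
    (u : nat -> 'cV[R]_(udim i)) (l : nat) : 'cV[R]_(xdim i) :=
  if l is l'.+1 then
    locstep (nomtraj x0 y u l') (fun j => y j l') + Bloc i *m u l'
  else x0.

End Network.

Section Design.
Variables (R : realType) (S : network R) (D : design S).
Notation I := 'I_(nsub S).
Notation M := (hor D).
Notation P := (Pmx D).

Definition Kmx : 'M[R]_(\sum_(i : I) udim i, \sum_(i : I) xdim i) :=
  blkdiag (Kloc D).
Definition AK : 'M[R]_(\sum_(i : I) xdim i) := Amx S + Bmx S *m Kmx.
Definition Phi (i j : I) : 'M[R]_(xdim i, xdim j) := submxblock (AK ^+ M) i j.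
Definition Phirow (i : I) : 'M[R]_(xdim i, \sum_(j : I) xdim j) :=
  \mxrow_j Phi i j.

Definition W (i : I) (xi : 'cV[R]_(xdim i)) : R := qform (P i) xi.
Definition V (x : state S) : R := \rmax_i (W (sub x i) / wgt D i).

(* max_j gamma_ij (W_j (x_j)) *)
Definition maxgain (i : I) (x : state S) : R := \rmax_j (gain D i j * W (sub x j)).

Definition gain_pattern : Prop :=
  forall i j, if Phi i j == 0 then gain D i j = 0 else 0 < gain D i j.

Definition cnorm (i j : I) : R :=
  opnorm (sqrtmx (P i) *m Phi i j *m invmx (sqrtmx (P j))).

Definition GA : Prop :=
  forall i, \sum_(j | 0 < cnorm i j) cnorm i j / Num.sqrt (gain D i j) <= 1.

Definition SDP (i : I) : Prop :=
  exists tau : I -> R,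
    [/\ forall j, 0 <= tau j,
        loewner_le ((Phirow i)^T *m P i *m Phirow i)
                   (\mxdiag_j (tau j *: P j)) &
        \sum_(j | Phi i j != 0) tau j / gain D i j <= 1].

Definition certificate (theta : R) : Prop :=
  [/\ forall i, posdef (P i), (2 <= M)%N, gain_pattern, GA \/ forall i, SDP i &
      [/\ forall i, 0 < wgt D i, 0 < theta < 1 &
          forall i j, 0 < gain D i j -> gain D i j * wgt D j <= theta * wgt D i]].

Definition admissible (D0 : set (state S)) : Prop :=
  [/\ D0 `<=` @Xset R S,
      (forall xi, D0 xi -> forall r, (r < M)%N ->
         Uset (Kmx *m AK ^+ r *m xi : input S)),
      (forall xi, D0 xi -> forall r, (1 <= r <= M)%N ->
         Xset (AK ^+ r *m xi : state S)) &
      exists2 al : R -> R, class_K al &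
        forall xi, D0 xi -> forall r, (r <= M)%N ->
          enorm (AK ^+ r *m xi) <= al (enorm xi)].

Definition cP : R := \rmax_i (lambda_max (P i) / wgt D i).
Definition cV : R :=
  (nsub S)%:R^-1 * inf [set lambda_min (P i) / wgt D i | i in [set: I]].
Definition cqi (i : I) : R :=
  \sum_(l < M) opnorm (sqrtmx (P i) *m Esel i *m AK ^+ l) ^+ 2.
Definition cq : R := \rmax_i (cqi i / wgt D i).
Definition kappaL (nu_int : R) : R := (1 + nu_int) * cq / cV.
Definition aL (theta nu_M : R) : R := (1 + nu_M) * theta.
Definition bL (nu_M : R) : R := (1 + nu_M^-1) * cP.

End Design.

(* The data of one closed-loop run: the state sequence, the selected optimizers
   ustar t i l = u_i^*(l|t) and rstar t i l = r_i^*(l|t) (1 <= l <= M-1), the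
   packets and disturbance terms used for initialization at t = 0, and the
   prescribed terminal terms d_i^ter(t). *)
Record run (R : realType) (S : network R) (D : design S) := Run {
  traj : nat -> state S;
  ustar : nat -> forall i : 'I_(nsub S), nat -> 'cV[R]_(udim i);
  rstar : nat -> 'I_(nsub S) -> nat -> R;
  xinit : forall j : 'I_(nsub S), nat -> 'cV[R]_(xdim j);
  rinit : 'I_(nsub S) -> nat -> R;
  dinit : 'I_(nsub S) -> nat -> R;
  dter : nat -> 'I_(nsub S) -> R
}.

Section ClosedLoop.
Variables (R : realType) (S : network R) (D : design S) (z : run D).
Notation I := 'I_(nsub S).
Notation M := (hor D).
Notation x := (traj z).

Definition uapp (t : nat) : input S := \mxcol_i ustar z t i 0%N.

(* \bar x_j(l|t), for 0 <= l <= M-1 *)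
Fixpoint xbar (t : nat) (j : I) (l : nat) : 'cV[R]_(xdim j) :=
  if l == 0%N then sub (x t) j
  else if t is t'.+1 then nomtraj (sub (x t') j) (xbar t') (ustar z t' j) l.+1
  else xinit z j l.

(* x_i^{nom,*}(l|t) *)
Definition xnoms (t : nat) (i : I) (l : nat) : 'cV[R]_(xdim i) :=
  nomtraj (sub (x t) i) (xbar t) (ustar z t i) l.

Definition dbar (t : nat) (i : I) (l : nat) : R :=
  if (l.+1 < M)%N then
    if t is t'.+1 then
      Lip2 i * nbrnorm i (fun j => xbar t j l - xbar t' j l.+1)
    else dinit z i l
  else dter z t i.

(* [budget_of] and [rstar_of] abstract the packet radii \bar r_j(.|t) as rb, so
   that rbar can be defined by recursion on t. *)
Definition budget_of (t : nat) (rb : I -> nat -> R) (i : I) (l : nat) : R :=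
  Lip2 i * (\rmax_(j | j \in nbr i) rb j l) + dbar t i l.

Definition rstar_of (t : nat) (rb : I -> nat -> R) (i : I) (l : nat) : R :=
  if l == 0%N then 0
  else if (l < M)%N then rstar z t i l
  else Lip1 i * rstar z t i M.-1 + budget_of t rb i M.-1.

(* \bar r_j(l|t), for 0 <= l <= M-1 *)
Fixpoint rbar (t : nat) (j : I) (l : nat) : R :=
  if l == 0%N then 0
  else if t is t'.+1 then rstar_of t' (rbar t') j l.+1
  else rinit z j l.

Definition budget (t : nat) : I -> nat -> R := budget_of t (rbar t).

(* r_i^*(l|t) for 0 <= l <= M, with its conventions at l = 0 and l = M *)
Definition rfull (t : nat) : I -> nat -> R := rstar_of t (rbar t).

Definition ocp_constraints (t : nat) (i : I)
    (u : nat -> 'cV[R]_(udim i)) (r : nat -> R) : Prop :=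
  let xn := nomtraj (sub (x t) i) (xbar t) u in
  let r0 l := if l == 0%N then 0 else r l in
  [/\ forall l, (l < M)%N -> Uloc (u l),
      forall l, (1 <= l < M)%N ->
        0 <= r l /\ pdiff (@Xloc R S i) (cball (r l)) (xn l),
      forall l, (l.+1 < M)%N -> Lip1 i * r0 l + budget t i l <= r0 l.+1 &
      W D (xn M) <= maxgain D i (x t)].

Definition ocp_cost (t : nat) (i : I)
    (u : nat -> 'cV[R]_(udim i)) (r : nat -> R) : R :=
  \sum_(0 <= l < M) W D (nomtraj (sub (x t) i) (xbar t) u l) +
  lam D * \sum_(1 <= l < M) r l.

Definition ocp_feasible (t : nat) (i : I) : Prop :=
  exists u r, @ocp_constraints t i u r.

Definition ocp_optimal (t : nat) (i : I)
    (u : nat -> 'cV[R]_(udim i)) (r : nat -> R) : Prop :=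
  @ocp_constraints t i u r /\
  forall u' r', @ocp_constraints t i u' r' ->
    @ocp_cost t i u r <= @ocp_cost t i u' r'.

Definition Jstar (t : nat) (i : I) : R :=
  inf [set c | exists u r, @ocp_constraints t i u r /\ c = @ocp_cost t i u r].

(* At a time at which OCP_i is infeasible the starred data are arbitrary. *)
Definition closed_loop : Prop :=
  [/\ forall t, x t.+1 = Amx S *m x t + Bmx S *m uapp t,
      forall t i, ocp_feasible t i -> @ocp_optimal t i (ustar z t i) (rstar z t i),
      forall i l, (1 <= l < M)%N -> 0 <= rinit z i l,
      forall i l, (l.+1 < M)%N -> 0 <= dinit z i l &
      forall t i, 0 <= dter z t i].

(* Shifted candidate at time t + 1: \tilde x_i^nom(l|t+1), \tilde r_i(l|t+1),
   chi_i(l|t+1). *)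
Definition xtil (t : nat) (i : I) (l : nat) : 'cV[R]_(xdim i) :=
  nomtraj (sub (x t.+1) i) (xbar t.+1) (fun k => ustar z t i k.+1) l.

Fixpoint rtil (t : nat) (i : I) (l : nat) : R :=
  if l is l'.+1 then Lip1 i * rtil t i l' + budget t.+1 i l' else 0.

Fixpoint chi (t : nat) (i : I) (l : nat) : R :=
  if l is l'.+1 then
    Lip1 i * chi t i l' +
    Lip2 i * nbrnorm i (fun j => xbar t.+1 j l' - xbar t j l'.+1)
  else 0.

Definition transition_ok (t : nat) (i : I) : Prop :=
  (forall (k : 'I_(xrows i)) l, (1 <= l < M)%N ->
     (Fmx i *m xnoms t i l.+1) k 0 +
       enorm (row k (Fmx i))^T * (chi t i l + rtil t i l) <= fvec i k 0) /\
  (exists2 v : 'cV[R]_(udim i), Uloc v &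
     enorm (sqrtmx (Pmx D i) *m
              (locstep (xtil t i M.-1) (fun j => xbar t.+1 j M.-1) + Bloc i *m v))
       <= Num.sqrt (maxgain D i (x t.+1))).

(* A transition t -> t+1 takes place only when all problems at time t are
   feasible. *)
Definition recursive_conditions : Prop :=
  (forall i, ocp_feasible 0 i) /\
  (forall t, (forall i, ocp_feasible t i) -> forall i, transition_ok t i).

Definition pmis (t : nat) (i : I) (l : nat) : R :=
  nbrnorm i (fun j => sub (x (t + l)%N) j - xbar t j l).
Definition deltau (t : nat) (i : I) (l : nat) : R :=
  enorm (ustar z (t + l)%N i 0%N - ustar z t i l).
Definition eta (t : nat) (i : I) (l : nat) : R :=
  Num.max (Lip2 i * pmis t i l + Lip3 i * deltau t i l - budget t i l) 0.
Fixpoint smis (t : nat) (i : I) (l : nat) : R :=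
  if l is l'.+1 then Lip1 i * smis t i l' + eta t i l' else 0.

Definition rho (t : nat) : R := \rmax_i (rfull t i M + smis t i M).
Definition epsL (t : nat) : R :=
  \rmax_(r < M) \rmax_i (rfull t i r + smis t i r).
Definition deltaJL (t : nat) : R :=
  \rmax_i ((wgt D i)^-1 *
           Num.max (Jstar t i - cqi D i * enorm (x t) ^+ 2) 0).
Definition DeltaL (nu_int : R) (t : nat) : R :=
  (1 + nu_int) * deltaJL t + (1 + nu_int^-1) * cP D * epsL t ^+ 2.

Definition run_hyps : Prop :=
  [/\ closed_loop, Xset (x 0%N) & recursive_conditions].

End ClosedLoop.

(* Main.v *)
Require Import Defs.
From mathcomp Require Import all_boot all_order all_algebra.
From mathcomp Require Import all_classical all_reals all_analysis.
From mathcomp Require Import complex lra ring.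

(* The packets are exact at l = 0, so x_i(t+1) is the first nominal prediction
   made at time t, and propagating from there the shifted candidate stays within
   chi_i(l|t+1) of the shifted optimal prediction; the tightened constraints
   absorb this distance, and v_i completes the candidate. This gives recursive
   feasibility. The true state stays within r_i + s_i of the nominal prediction,
   so Young's inequality for the quadratic forms W_i turns the terminal gain
   condition into V(x(t+M)) <= a_L V(x(t)) + b_L rho(t)^2, and the bound
   W_i <= J_i^* on the predicted states into the intermediate estimate. The
   remaining claims iterate this M-step contraction along each residue class
   modulo M, using c_V |x|^2 <= V(x) <= c_P |x|^2. *)

Set Implicit Arguments.
Unset Strict Implicit.
Unset Printing Implicit Defensive.

Import Order.TTheory GRing.Theory Num.Theory.
Import numFieldNormedType.Exports.

Local Open Scope classical_set_scope.
Local Open Scope ring_scope.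

(** * Euclidean norms and symmetric matrices *)

Section Euclidean.
Variable R : realType.

Lemma sqr_enorm n (v : 'cV[R]_n) : enorm v ^+ 2 = \sum_i v i 0 ^+ 2.
Proof. by rewrite sqr_sqrtr // sumr_ge0 // => i _; rewrite sqr_ge0. Qed.

Lemma sqr_enormE n (v : 'cV[R]_n) : enorm v ^+ 2 = (v^T *m v) 0 0.
Proof.
by rewrite sqr_enorm mxE; apply: eq_bigr => i _; rewrite mxE expr2.
Qed.

Lemma enorm_ge0 n (v : 'cV[R]_n) : 0 <= enorm v.
Proof. exact: sqrtr_ge0. Qed.

Lemma enorm0 n : enorm (0 : 'cV[R]_n) = 0.
Proof.
by rewrite /enorm big1 ?sqrtr0 // => i _; rewrite mxE expr0n.
Qed.

Lemma enorm_eq0 n (v : 'cV[R]_n) : enorm v = 0 -> v = 0.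
Proof.
move=> v0; have : enorm v ^+ 2 = 0 by rewrite v0 expr0n.
rewrite sqr_enorm => /eqP; rewrite psumr_eq0; last by move=> i _; rewrite sqr_ge0.
move=> /allP h; apply/colP => i; rewrite mxE; apply/eqP.
by rewrite -sqrf_eq0; apply: (h i); rewrite mem_index_enum.
Qed.

Lemma enormZ n (c : R) (v : 'cV[R]_n) : enorm (c *: v) = `|c| * enorm v.
Proof.
rewrite /enorm -sqrtr_sqr -sqrtrM ?sqr_ge0 // mulr_sumr; congr Num.sqrt.
by apply: eq_bigr => i _; rewrite mxE exprMn.
Qed.

(** The quadratic [t |-> \sum_i (a i - t * b i) ^+ 2] is nonnegative. Its value at the minimizer
    [C / B] gives the bound; [B = 0] forces every [b i] to vanish. *)
Lemma cauchy_schwarz_sum (I : finType) (a b : I -> R) :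
  (\sum_i a i * b i) ^+ 2 <= (\sum_i a i ^+ 2) * (\sum_i b i ^+ 2).
Proof.
set A := \sum_i a i ^+ 2; set B := \sum_i b i ^+ 2; set C := \sum_i a i * b i.
have ge0 t : 0 <= A - 2 * t * C + t ^+ 2 * B.
  suff -> : A - 2 * t * C + t ^+ 2 * B = \sum_i (a i - t * b i) ^+ 2.
    by apply: sumr_ge0 => i _; rewrite sqr_ge0.
  rewrite /A /B /C !mulr_sumr -sumrB -big_split /=; apply: eq_bigr => i _; ring.
have [B0|B0] := eqVneq B 0.
  have b0 i : b i = 0.
    move/eqP: B0; rewrite psumr_eq0 => [/allP/(_ i (mem_index_enum _))|j _].
      by rewrite sqrf_eq0 => /eqP.
    exact: sqr_ge0.
  by rewrite /C big1 ?expr0n ?B0 ?mulr0 // => i _; rewrite b0 mulr0.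
have Bgt0 : 0 < B by rewrite lt_neqAle eq_sym B0 sumr_ge0 // => i _; rewrite sqr_ge0.
have := ge0 (C / B); rewrite -(pmulr_rge0 _ Bgt0).
suff -> : B * (A - 2 * (C / B) * C + (C / B) ^+ 2 * B) = A * B - C ^+ 2.
  by rewrite subr_ge0.
by field.
Qed.

Lemma dot_le_enorm n (u v : 'cV[R]_n) : (u^T *m v) 0 0 <= enorm u * enorm v.
Proof.
apply: le_trans (ler_norm _) _.
rewrite -ler_sqr ?nnegrE ?mulr_ge0 ?enorm_ge0 // real_normK ?num_real //.
rewrite exprMn !sqr_enorm mxE; under eq_bigr do rewrite mxE.
exact: cauchy_schwarz_sum.
Qed.

Lemma enormD n (u v : 'cV[R]_n) : enorm (u + v) <= enorm u + enorm v.
Proof.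
rewrite -ler_sqr ?nnegrE ?addr_ge0 ?enorm_ge0 // sqr_enormE.
have -> : ((u + v)^T *m (u + v)) 0 0 =
    enorm u ^+ 2 + 2 * (u^T *m v) 0 0 + enorm v ^+ 2.
  rewrite !sqr_enorm !mxE mulr_sumr -!big_split /=; apply: eq_bigr => i _.
  rewrite !mxE; ring.
have := dot_le_enorm u v; rewrite sqrrD; lra.
Qed.

Lemma enorm_sum n (I : finType) (A : pred I) (v : I -> 'cV[R]_n) :
  enorm (\sum_(i | A i) v i) <= \sum_(i | A i) enorm (v i).
Proof.
elim/big_rec2: _ => [|i y x _ le_xy]; first by rewrite enorm0.
by apply: le_trans (enormD _ _) _; rewrite lerD2l.
Qed.

(** The Frobenius norm is a bound, by Cauchy-Schwarz on each row. This makes the supremum defining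
    [opnorm] a true upper bound. *)
Lemma enorm_mulmx_bounded m n (A : 'M[R]_(m, n)) :
  has_ubound [set enorm (A *m v) | v in [set v : 'cV[R]_n | enorm v <= 1]].
Proof.
exists (Num.sqrt (\sum_i \sum_j A i j ^+ 2)) => _ [v /= v1 <-].
rewrite ler_sqrt; last by
  rewrite sumr_ge0 // => i _; rewrite sumr_ge0 // => j _; rewrite sqr_ge0.
apply: ler_sum => i _; rewrite mxE; apply: le_trans (cauchy_schwarz_sum _ _) _.
rewrite -sqr_enorm -[leRHS]mulr1 ler_wpM2l ?expr_le1 ?enorm_ge0 //.
by rewrite sumr_ge0 // => j _; rewrite sqr_ge0.
Qed.

Lemma opnorm_ge0 m n (A : 'M[R]_(m, n)) : 0 <= opnorm A.
Proof.
apply: le_trans (enorm_ge0 (A *m 0)) _; apply: ub_le_sup.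
  exact: enorm_mulmx_bounded.
by exists 0; rewrite //= enorm0.
Qed.

Lemma enorm_mulmx m n (A : 'M[R]_(m, n)) (v : 'cV[R]_n) :
  enorm (A *m v) <= opnorm A * enorm v.
Proof.
have [v0|v0] := eqVneq (enorm v) 0.
  by rewrite v0 (enorm_eq0 v0) mulmx0 enorm0 mulr0.
have vgt0 : 0 < enorm v by rewrite lt_neqAle eq_sym v0 enorm_ge0.
rewrite -ler_pdivrMr //.
have -> : enorm (A *m v) / enorm v = enorm (A *m ((enorm v)^-1 *: v)).
  by rewrite -scalemxAr enormZ ger0_norm ?invr_ge0 ?enorm_ge0 // mulrC.
apply: ub_le_sup; first exact: enorm_mulmx_bounded.
exists ((enorm v)^-1 *: v) => //=.
by rewrite enormZ ger0_norm ?invr_ge0 ?enorm_ge0 // mulVf.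
Qed.

End Euclidean.

(** * Spectral theorem for real symmetric matrices, and principal square roots *)

Section Spectral.
Variable R : realType.

(** The complexified matrix has an eigenvalue [a] with eigenvector [v]. With [w] the conjugate
    transpose of [v], the number [v P w] is self-conjugate and [v w] is positive, so their quotient
    [a] is real. *)
Lemma symmetric_eigenvalue n (P : 'M[R]_n) : (0 < n)%N -> P^T = P ->
  exists c, eigenvalue P c.
Proof.
move=> n_gt0 Psym; pose Pc := map_mx (real_complex R) P.
have [a /eigenvalueP[v Pv v0]] := eigenvalue_closed Pc n_gt0.
suff areal : a \is Num.real.
  by exists (complex.Re a); rewrite -(eigenvalue_map (real_complex R)) /= RRe_real //;
    apply/eigenvalueP; exists v.
pose w := map_mx Num.conj v^T.
pose N := v *m Pc *m w; pose s := (v *m w) 0 0.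
have s_gt0 : 0 < s.
  have s_def : s = \sum_i `|v 0 i| ^+ 2.
    by rewrite /s mxE; apply: eq_bigr => i _; rewrite !mxE normCK.
  rewrite s_def lt_neqAle eq_sym sumr_ge0 ?andbT; last by move=> i _; rewrite exprn_ge0.
  apply: contraNneq v0 => /eqP; rewrite psumr_eq0; last by move=> i _; rewrite exprn_ge0.
  move=> /allP h; apply/eqP/rowP => i; rewrite mxE; apply/eqP.
  by rewrite -normr_eq0 -sqrf_eq0; apply: (h i); rewrite mem_index_enum.
have Nconj : map_mx Num.conj N^T = N.
  rewrite /N !trmx_mul !map_mxM /= mulmxA; congr (_ *m _ *m _).
  - by apply/matrixP => i j; rewrite !mxE conjCK.
  - apply/matrixP => i j; rewrite /Pc -[in RHS]Psym !mxE.
    by apply/CrealP; apply/complex_realP; exists (P j i).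
have Nreal : N 0 0 \is Num.real.
  by apply/CrealP; rewrite -[in RHS]Nconj !mxE.
have aE : a = N 0 0 / s.
  by rewrite /N Pv -scalemxAl mxE mulfK // gt_eqF.
by rewrite aE realM ?realV // gtr0_real.
Qed.

(* H is the Householder reflection that exchanges u and the first basis vector. *)
Lemma reflection_to n (u : 'rV[R]_(1 + n)) : u *m u^T = 1%:M ->
  exists H : 'M[R]_(1 + n),
    [/\ H^T = H, H *m H = 1%:M & delta_mx 0 0 *m H = u].
Proof.
move=> uu; pose e : 'rV[R]_(1 + n) := delta_mx 0 0; pose w := e - u.
have ee : e *m e^T = 1%:M.
  by rewrite /e trmx_delta mul_delta_mx; apply/matrixP => i j; rewrite !ord1 !mxE.
have [w0|w0] := eqVneq w 0.
  exists 1%:M; rewrite trmx1 !mulmx1; split=> //.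
  by apply/eqP; rewrite -subr_eq0 -/e -/w w0.
pose k := (w *m w^T) 0 0; pose g := (e *m w^T) 0 0.
have eu : u *m e^T = e *m u^T.
  by apply: trmx_inj; rewrite !trmx_mul !trmxK; apply/matrixP => i j;
    rewrite !ord1 [LHS]mxE [RHS]mxE; apply: eq_bigr => x _; rewrite !mxE mulrC.
(* As [e] and [u] are unit vectors, the squared length of [w = e - u] is twice the product of [e]
   and [w]; hence reflecting [e] along [w] subtracts exactly [w] and yields [u]. *)
have kE : k = 2 * g.
  rewrite /k /g /w linearB /= !mulmxBr !mulmxBl ee uu eu !mxE; ring.
have k0 : k != 0.
  apply: contraNneq w0; rewrite /k => /eqP; rewrite mxE psumr_eq0 => [/allP h|i _].
    apply/eqP/rowP => i; have := h i (mem_index_enum _).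
    by rewrite /= [w^T _ _]mxE -expr2 sqrf_eq0 [in RHS]mxE => /eqP.
  by rewrite [w^T _ _]mxE -expr2 sqr_ge0.
have ww : w *m w^T = k%:M by rewrite [LHS]mx11_scalar.
have ew : e *m w^T = g%:M by rewrite [LHS]mx11_scalar.
pose H := 1%:M - (2 / k) *: (w^T *m w).
exists H; split.
- by rewrite /H linearB /= linearZ /= trmx1 trmx_mul trmxK.
- rewrite /H mulmxBr mulmx1 mulmxBl mul1mx -scalemxAl -scalemxAr.
  rewrite mulmxA -(mulmxA w^T) ww mul_mx_scalar -scalemxAl !scalerA.
  have -> : 2 / k * (2 / k * k) = 2 / k + 2 / k by field.
  by rewrite scalerDl; apply/matrixP=> i j; rewrite !mxE; ring.
- rewrite /H mulmxBr mulmx1 -scalemxAr mulmxA ew mul_scalar_mx scalerA.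
  have -> : 2 / k * g = 1 by rewrite kE; field; move: k0; rewrite kE mulf_eq0 negb_or => /andP[].
  by rewrite scale1r /w subKr.
Qed.

(** Induction on the dimension: a reflection moves a unit eigenvector to the first basis vector,
    symmetry makes the conjugated matrix block diagonal, and the induction hypothesis treats the
    remaining block. *)
Lemma symmetric_diagonalizable n (P : 'M[R]_n) : P^T = P ->
  exists (Q : 'M[R]_n) (d : 'rV[R]_n), Q *m Q^T = 1%:M /\ P = Q^T *m diag_mx d *m Q.
Proof.
elim: n P => [|n IHn] P Psym.
  by exists 1%:M, 0; split; rewrite ?trmx1 ?mulmx1 //; apply/matrixP=> [[]].
have [c /eigenvalueP[v Pv v0]] := symmetric_eigenvalue (ltn0Sn n) Psym.
have en : 0 < enorm v^T.
  rewrite lt_neqAle eq_sym enorm_ge0 andbT.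
  by apply: contraNneq v0 => /enorm_eq0/(congr1 trmx); rewrite trmxK trmx0 => ->.
pose u : 'rV[R]_(1 + n) := (enorm v^T)^-1 *: v.
have uu : u *m u^T = 1%:M.
  rewrite /u linearZ /= -scalemxAl -scalemxAr scalerA [v *m _]mx11_scalar.
  have -> : (v *m v^T) 0 0 = enorm v^T ^+ 2 by rewrite sqr_enormE trmxK.
  by rewrite scale_scalar_mx -expr2 exprVn mulVf // expf_neq0 // gt_eqF.
have [H [Hsym HH eH]] := reflection_to uu.
have [B B_def] : exists B : 'M[R]_(1 + n), B = H *m P *m H by exists (H *m P *m H).
have PB : P = H *m B *m H by rewrite B_def !mulmxA HH mul1mx -mulmxA HH mulmx1.
have Bsym : B^T = B by rewrite B_def !trmx_mul Hsym Psym mulmxA.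
have eB : (delta_mx 0 0 : 'rV_(1 + n)) *m B = c *: delta_mx 0 0.
  rewrite B_def !mulmxA eH {1}/u -scalemxAl Pv scalerA mulrC -scalerA -/u.
  by rewrite -scalemxAl -eH -mulmxA HH mulmx1.
have B0j j : B 0 j = c * (j == 0)%:R.
  by move/matrixP: eB => /(_ 0 j); rewrite -rowE !mxE eqxx.
have Bur : ursubmx B = 0.
  by apply/matrixP => i j; rewrite ord1 !mxE lshift0 B0j -val_eqE mulr0.
have Bul : ulsubmx B = c%:M.
  by apply/matrixP => i j; rewrite !mxE !ord1 lshift0 B0j eqxx mulr1.
have Bdl : dlsubmx B = 0 by rewrite -Bsym -trmx_ursub Bur trmx0.
have Bblock : B = block_mx c%:M 0 0 (drsubmx B).
  by rewrite -[LHS]submxK Bul Bur Bdl.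
have [Q [d [QQ dQ]]] : exists (Q : 'M[R]_n) (d : 'rV[R]_n), Q *m Q^T = 1%:M /\
    drsubmx B = Q^T *m diag_mx d *m Q.
  by apply: IHn; rewrite trmx_drsub Bsym.
pose Q1 : 'M[R]_(1 + n) := block_mx 1%:M 0 0 Q.
have Q1T : Q1^T = block_mx 1%:M 0 0 Q^T by rewrite tr_block_mx !trmx0 trmx1.
have QQ1 : Q1 *m Q1^T = 1%:M.
  by rewrite Q1T mulmx_block !mulmx0 !mul0mx !addr0 !add0r mulmx1 QQ -scalar_mx_block.
have BQ : B = Q1^T *m diag_mx (row_mx c%:M d) *m Q1.
  have c1 : diag_mx (c%:M : 'rV_1) = c%:M.
    by apply/matrixP => i j; rewrite !ord1 !mxE.
  rewrite Bblock dQ Q1T diag_mx_row c1 !mulmx_block.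
  by rewrite !(mulmx0, mul0mx, addr0, add0r, mulmx1, mul1mx).
exists (Q1 *m H), (row_mx c%:M d); split.
  by rewrite trmx_mul Hsym mulmxA -(mulmxA Q1) HH mulmx1 QQ1.
by rewrite trmx_mul Hsym PB BQ !mulmxA.
Qed.

Lemma orthogonal_enorm n (Q : 'M[R]_n) v : Q *m Q^T = 1%:M ->
  enorm (Q *m v) = enorm v.
Proof.
move=> /mulmx1C QQ; apply/eqP; rewrite -(@eqrXn2 _ 2) ?enorm_ge0 // !sqr_enormE.
by rewrite trmx_mul mulmxA -(mulmxA v^T) QQ mulmx1.
Qed.

Lemma qform_diag n (Q : 'M[R]_n) d v :
  qform (Q^T *m diag_mx d *m Q) v = \sum_i d 0 i * (Q *m v) i 0 ^+ 2.
Proof.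
rewrite /qform !mulmxA -trmx_mul -!mulmxA; move: (Q *m v) => y.
by rewrite mxE; apply: eq_bigr => i _; rewrite mul_diag_mx !mxE; ring.
Qed.

(** Turns [lambda_max] and [lambda_min] into the supremum and infimum of finitely many diagonal
    entries; the rows of [Q] are the eigenvectors. *)
Lemma eigenvalues_diag n (Q : 'M[R]_n) d : Q *m Q^T = 1%:M ->
  [set c | eigenvalue (Q^T *m diag_mx d *m Q) c] = range (d 0).
Proof.
move=> QQ; have QtQ := mulmx1C QQ; apply/seteqP; split=> c /=.
  move=> /eigenvalueP[v vP v0]; pose y := v *m Q^T.
  have yd : y *m diag_mx d = c *: y.
    by rewrite /y scalemxAl -vP !mulmxA -(mulmxA _ Q) QQ mulmx1.
  have /rV0Pn[i yi] : y != 0.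
    by apply: contraNneq v0 => y0; rewrite -[v]mulmx1 -QtQ mulmxA -/y y0 mul0mx.
  exists i => //; apply: (mulIf yi).
  by move/rowP: yd => /(_ i); rewrite mul_mx_diag !mxE mulrC.
move=> [i _ <-]; apply/eigenvalueP; exists (row i Q).
  rewrite !mulmxA -row_mul QQ row1 -rowE row_diag_mx -scalemxAl.
  by rewrite -rowE.
apply/eqP => rQ0; move/(congr1 (row i)): QQ; rewrite row_mul rQ0 mul0mx row1.
by move=> /rowP/(_ i); rewrite !mxE !eqxx => /esym/eqP; rewrite oner_eq0.
Qed.

Section EigenvalueBounds.
Variables (n : nat) (P : 'M[R]_n).
Hypothesis Psym : P^T = P.

Lemma has_ubound_range_fin (I : finType) (d : I -> R) : has_ubound (range d).
Proof. by exists (\big[Num.max/0]_i d i) => _ [i _ <-]; exact: le_bigmax. Qed.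

Lemma has_lbound_range_fin (I : finType) (d : I -> R) : has_lbound (range d).
Proof. by exists (\big[Num.min/0]_i d i) => _ [i _ <-]; exact: bigmin_le. Qed.

Lemma qform_le_lambda_max v : qform P v <= lambda_max P * enorm v ^+ 2.
Proof.
have [Q [d [QQ PE]]] := symmetric_diagonalizable Psym.
rewrite -(orthogonal_enorm v QQ) sqr_enorm mulr_sumr {1}PE qform_diag.
apply: ler_sum => i _; rewrite ler_wpM2r ?sqr_ge0 //.
rewrite /lambda_max PE eigenvalues_diag //; apply: ub_le_sup => //.
exact: has_ubound_range_fin.
Qed.

Lemma lambda_min_le_qform v : lambda_min P * enorm v ^+ 2 <= qform P v.
Proof.
have [Q [d [QQ PE]]] := symmetric_diagonalizable Psym.
rewrite -(orthogonal_enorm v QQ) sqr_enorm mulr_sumr {2}PE qform_diag.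
apply: ler_sum => i _; rewrite ler_wpM2r ?sqr_ge0 //.
rewrite /lambda_min PE eigenvalues_diag //; apply: ge_inf => //.
exact: has_lbound_range_fin.
Qed.

End EigenvalueBounds.

Lemma inf_range_fin_gt0 (I : finType) (d : I -> R) (i0 : I) :
  (forall i, 0 < d i) -> 0 < inf (range d).
Proof.
move=> d_gt0; have [i _ di] := arg_minP d (isT : predT i0).
apply: lt_le_trans (d_gt0 i) _; apply: lb_le_inf; first by exists (d i0); exists i0.
by move=> _ [j _ <-]; exact: di.
Qed.

Lemma posdef_qform_ge0 n (P : 'M[R]_n) v : posdef P -> 0 <= qform P v.
Proof.
move=> [_ Ppos]; have [->|/Ppos/ltW //] := eqVneq v 0.
by rewrite /qform mulmx0 mxE.
Qed.

Lemma posdef_diagonalizable n (P : 'M[R]_n) : posdef P ->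
  exists (Q : 'M[R]_n) (d : 'rV[R]_n),
    [/\ Q *m Q^T = 1%:M, P = Q^T *m diag_mx d *m Q & forall i, 0 < d 0 i].
Proof.
move=> [Psym Ppos]; have [Q [d [QQ PE]]] := symmetric_diagonalizable Psym.
(* The quadratic form takes the value [d 0 i] at the [i]-th eigenvector [Q^T *m delta_mx i 0]. *)
exists Q, d; split=> // i; have := Ppos (Q^T *m delta_mx i 0).
rewrite PE qform_diag mulmxA QQ mul1mx (bigD1 i) //= big1 => [|j ji].
  rewrite addr0 mxE !eqxx expr1n mulr1; apply.
  apply/eqP => /(congr1 (mulmx Q)); rewrite mulmxA QQ mul1mx mulmx0.
  by move=> /colP/(_ i); rewrite !mxE !eqxx => /eqP; rewrite oner_eq0.
by rewrite mxE (negPf ji) expr0n mulr0.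
Qed.

Lemma lambda_min_gt0 n (P : 'M[R]_n) : (0 < n)%N -> posdef P -> 0 < lambda_min P.
Proof.
case: n P => // n P _ /posdef_diagonalizable[Q [d [QQ PE d_gt0]]].
by rewrite /lambda_min PE eigenvalues_diag //; apply: (inf_range_fin_gt0 ord0).
Qed.

(** Since [sqrtmx] is a choice by [xget], it suffices to exhibit one positive semidefinite root:
    take square roots of the eigenvalues. *)
Lemma sqrtmxP n (P : 'M[R]_n) : posdef P ->
  possemidef (sqrtmx P) /\ sqrtmx P *m sqrtmx P = P.
Proof.
move=> /posdef_diagonalizable[Q [d [QQ PE d_gt0]]].
apply: (@xgetPex _ 0 [set Q | possemidef Q /\ Q *m Q = P]).
pose e := \row_i Num.sqrt (d 0 i).
exists (Q^T *m diag_mx e *m Q); split; first split.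
- by rewrite !trmx_mul trmxK tr_diag_mx mulmxA.
- move=> v; rewrite qform_diag sumr_ge0 // => i _.
  by rewrite mulr_ge0 ?sqr_ge0 // mxE sqrtr_ge0.
- rewrite PE !mulmxA -(mulmxA _ Q) QQ mulmx1 -(mulmxA Q^T) mulmx_diag.
  congr (_ *m diag_mx _ *m _); apply/rowP => i; rewrite !mxE -expr2 sqr_sqrtr //.
  exact/ltW.
Qed.

Lemma qform_sqrtmx n (P : 'M[R]_n) v : posdef P ->
  qform P v = enorm (sqrtmx P *m v) ^+ 2.
Proof.
move=> /sqrtmxP[[sym _] sq].
by rewrite sqr_enormE trmx_mul sym mulmxA -(mulmxA v^T) sq.
Qed.

(** Young's inequality: in terms of the square root of [P], the gap is at least
    [(nu * enorm a - enorm b) ^+ 2 / nu]. *)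
Lemma qformD_le n (P : 'M[R]_n) (nu : R) u v : posdef P -> 0 < nu ->
  qform P (u + v) <= (1 + nu) * qform P u + (1 + nu^-1) * qform P v.
Proof.
move=> Ppd nu_gt0; rewrite !qform_sqrtmx // mulmxDr.
set a := sqrtmx P *m u; set b := sqrtmx P *m v.
have le_ab : enorm (a + b) ^+ 2 <= (enorm a + enorm b) ^+ 2.
  by rewrite ler_sqr ?nnegrE ?addr_ge0 ?enorm_ge0 // enormD.
apply: le_trans le_ab _; rewrite -subr_ge0.
have -> : (1 + nu) * enorm a ^+ 2 + (1 + nu^-1) * enorm b ^+ 2 -
    (enorm a + enorm b) ^+ 2 = (nu * enorm a - enorm b) ^+ 2 / nu.
  by field; exact: lt0r_neq0.
by rewrite divr_ge0 ?sqr_ge0 // ltW.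
Qed.

End Spectral.

(** * The network and one closed-loop run *)

Lemma submxcol_mulmx (R : pzSemiRingType) m n (p : 'I_m -> nat) (q : 'I_n -> nat)
    (A : 'M[R]_(\sum_i p i, \sum_i q i)) (x : 'cV[R]_(\sum_i q i)) i :
  submxcol (A *m x) i = \sum_j submxblock A i j *m submxcol x j.
Proof.
rewrite -submxcol_mul -{1}(submxcolK x) -{1}(submxrowK (submxcol A i)).
by rewrite mul_mxrow_mxcol; apply: eq_bigr => j _; rewrite submxblockEv.
Qed.

Lemma sqr_enorm_submxcol (R : realType) n (q : 'I_n -> nat)
    (x : 'cV[R]_(\sum_i q i)) :
  enorm x ^+ 2 = \sum_i enorm (submxcol x i) ^+ 2.
Proof.
rewrite sqr_enormE -{1 2}(submxcolK x) tr_mxcol mul_mxrow_mxcol summxE.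
by apply: eq_bigr => i _; rewrite sqr_enormE.
Qed.

Section NetworkFacts.
Variables (R : realType) (S : network R).
Notation I := 'I_(nsub S).

Lemma sub_mulA (x : state S) (i : I) :
  sub (Amx S *m x) i = locstep (sub x i) (fun j => sub x j).
Proof.
rewrite /sub submxcol_mulmx (bigD1 i) //= /locstep; congr (_ + _).
rewrite (bigID (mem (nbr i))) /= [X in _ + X]big1 => [|j /andP[ji jN]].
  rewrite addr0; apply: eq_bigl => j; have [->|//] := eqVneq j i.
  by rewrite (negPf (nbr_irr i)).
by rewrite nbr_coupling // mul0mx.
Qed.

Lemma sub_mulB (u : input S) (i : I) : sub (Bmx S *m u) i = Bloc i *m subu u i.
Proof.
rewrite /sub submxcol_mulmx (bigD1 i) //= big1 => [|j ji].
  by rewrite addr0 /Bmx /blkdiag mxblockK eqxx conform_mx_id.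
by rewrite /Bmx /blkdiag mxblockK eq_sym (negPf ji) mul0mx.
Qed.

Lemma Lip2_ge0 (i : I) : 0 <= Lip2 i.
Proof. by apply: sumr_ge0 => j _; exact: opnorm_ge0. Qed.

Lemma nbrnorm_ge0 (i : I) (v : forall j : I, 'cV[R]_(xdim j)) : 0 <= nbrnorm i v.
Proof. exact: bigmax_ge_id. Qed.

(** The one-step Lipschitz estimate behind both error recursions, [chi] and [smis]. The maximum over
    the neighbors factors out of the sum, leaving the sum of operator norms [Lip2 i]. *)
Lemma enorm_locstepB (i : I) (a b : 'cV[R]_(xdim i))
    (y y' : forall j : I, 'cV[R]_(xdim j)) :
  enorm (locstep a y - locstep b y') <=
    Lip1 i * enorm (a - b) + Lip2 i * nbrnorm i (fun j => y j - y' j).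
Proof.
have -> : locstep a y - locstep b y' =
    Ablk i i *m (a - b) + \sum_(j in nbr i) Ablk i j *m (y j - y' j).
  rewrite /locstep opprD addrACA mulmxBr -sumrB; congr (_ + _).
  by apply: eq_bigr => j _; rewrite mulmxBr.
apply: le_trans (enormD _ _) _; apply: lerD; first exact: enorm_mulmx.
apply: le_trans (enorm_sum _ _) _; rewrite /Lip2 mulr_suml; apply: ler_sum => j jN.
apply: le_trans (enorm_mulmx _ _) _; rewrite ler_wpM2l ?opnorm_ge0 //.
exact: (le_bigmax_cond _ (fun j => enorm (y j - y' j))).
Qed.

End NetworkFacts.

(** * Comparison of [V] with the squared norm, and the gain and perturbation bounds *)

Section DesignFacts.
Variables (R : realType) (S : network R) (D : design S).
Notation I := 'I_(nsub S).
Notation P := (Pmx D).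
Hypothesis Ppd : forall i, posdef (P i).
Hypothesis wgt_gt0 : forall i, 0 < wgt D i.

Lemma W_ge0 (i : I) (xi : 'cV[R]_(xdim i)) : 0 <= W D xi.
Proof. exact: posdef_qform_ge0. Qed.

Lemma V_ge0 x : 0 <= V D x.
Proof. exact: bigmax_ge_id. Qed.

Lemma W_le_V x (i : I) : W D (sub x i) <= V D x * wgt D i.
Proof.
by rewrite -ler_pdivrMr //; exact: (le_bigmax _ (fun i => W D (sub x i) / wgt D i)).
Qed.

Lemma V_le (x : state S) (c : R) : 0 <= c ->
  (forall i, W D (sub x i) <= c * wgt D i) -> V D x <= c.
Proof. by move=> c0 Wc; apply: bigmax_le => // i _; rewrite ler_pdivrMr. Qed.

Lemma cP_ge0 : 0 <= cP D.
Proof. exact: bigmax_ge_id. Qed.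

Lemma W_le_cP (i : I) (xi : 'cV[R]_(xdim i)) : W D xi <= cP D * enorm xi ^+ 2 * wgt D i.
Proof.
have [Psym _] := Ppd i; apply: le_trans (qform_le_lambda_max Psym xi) _.
rewrite mulrAC ler_wpM2r ?sqr_ge0 // -ler_pdivrMr //.
exact: (le_bigmax _ (fun i => lambda_max (P i) / wgt D i)).
Qed.

Lemma enorm_sub_le (x : state S) (i : I) : enorm (sub x i) ^+ 2 <= enorm x ^+ 2.
Proof.
rewrite [leRHS]sqr_enorm_submxcol (bigD1 i) //= lerDl.
by apply: sumr_ge0 => j _; rewrite sqr_ge0.
Qed.

Lemma V_le_cP x : V D x <= cP D * enorm x ^+ 2.
Proof.
apply: V_le => [|i]; first by rewrite mulr_ge0 ?cP_ge0 ?sqr_ge0.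
apply: le_trans (W_le_cP _) _; rewrite ler_wpM2r ?(ltW (wgt_gt0 i)) //.
by rewrite ler_wpM2l ?cP_ge0 // enorm_sub_le.
Qed.

Lemma cV_gt0 : 0 < cV D.
Proof.
rewrite /cV mulr_gt0 ?invr_gt0 ?ltr0n ?nsub_gt0 //.
apply: (inf_range_fin_gt0 (Ordinal (nsub_gt0 S))) => i.
by rewrite divr_gt0 // lambda_min_gt0 // xdim_gt0.
Qed.

(** The maximum over the subsystems dominates the mean, which accounts for the factor one over
    [nsub S] in [cV]. *)
Lemma cV_le_V x : cV D * enorm x ^+ 2 <= V D x.
Proof.
have n_gt0 : 0 < (nsub S)%:R :> R by rewrite ltr0n nsub_gt0.
rewrite /cV -mulrA ler_pdivrMl //.
have -> : (nsub S)%:R * V D x = \sum_(i : I) V D x.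
  by rewrite sumr_const card_ord mulr_natl.
rewrite sqr_enorm_submxcol mulr_sumr; apply: ler_sum => i _.
apply: le_trans (le_bigmax _ (fun i => W D (sub x i) / wgt D i) i).
rewrite ler_pdivlMr // mulrAC; have [Psym _] := Ppd i.
apply: le_trans (lambda_min_le_qform Psym _); rewrite ler_wpM2r ?sqr_ge0 //.
rewrite -ler_pdivlMr //; apply: ge_inf; last by exists i.
exact: has_lbound_range_fin.
Qed.

Lemma sqr_enorm_le_V x : enorm x ^+ 2 <= V D x / cV D.
Proof. by rewrite ler_pdivlMr ?cV_gt0 // mulrC cV_le_V. Qed.

Lemma cq_ge0 : 0 <= cq D.
Proof. exact: bigmax_ge_id. Qed.

Lemma kappaL_ge0 nu : 0 < nu -> 0 <= kappaL D nu.
Proof.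
move=> nu0; rewrite divr_ge0 ?(ltW cV_gt0) // mulr_ge0 ?cq_ge0 //.
by rewrite addr_ge0 // ltW.
Qed.

Lemma maxgain_ge0 (i : I) x : 0 <= maxgain D i x.
Proof. exact: bigmax_ge_id. Qed.

Lemma maxgain_le theta (i : I) x : certificate D theta ->
  maxgain D i x <= theta * V D x * wgt D i.
Proof.
move=> [_ _ gp _ [_ /andP[/ltW th0 _] gth]].
apply: bigmax_le => [|j _]; first by rewrite !mulr_ge0 ?V_ge0 // ltW.
have [->|g0] := eqVneq (gain D i j) 0.
  by rewrite mul0r !mulr_ge0 ?V_ge0 // ltW.
(* The gain pattern leaves only zero or positive gains. *)
have g_gt0 : 0 < gain D i j by have := gp i j; case: ifP => // _ /eqP; rewrite (negPf g0).
apply: le_trans (_ : gain D i j * (V D x * wgt D j) <= _).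
  by rewrite ler_wpM2l ?W_le_V // ltW.
have := ler_wpM2l (V_ge0 x) (gth i j g_gt0); lra.
Qed.

(** Shared by the intermediate and the [M]-step estimates: [y] is the nominal prediction, [e] its
    error, [c] the nominal level of the weighted [W]. *)
Lemma V_perturb_le (nu c d : R) (y e : forall i : I, 'cV[R]_(xdim i)) x :
  0 < nu -> 0 <= c ->
  (forall i, sub x i = y i + e i) ->
  (forall i, W D (y i) <= c * wgt D i) ->
  (forall i, enorm (e i) <= d) ->
  V D x <= (1 + nu) * c + (1 + nu^-1) * cP D * d ^+ 2.
Proof.
move=> nu0 c0 xE Wy ed.
have nu'0 : 0 <= 1 + nu^-1 by rewrite addr_ge0 // invr_ge0 ltW.
apply: V_le => [|i].
  have nu1 : 0 <= 1 + nu by rewrite addr_ge0 // ltW.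
  apply: addr_ge0; first exact: mulr_ge0.
  by apply: mulr_ge0; [apply: mulr_ge0; rewrite // cP_ge0 | rewrite sqr_ge0].
rewrite xE; apply: le_trans (qformD_le _ _ (Ppd i) nu0) _; rewrite [leRHS]mulrDl lerD //.
  by rewrite -mulrA ler_wpM2l ?Wy // addr_ge0 // ltW.
have -> : (1 + nu^-1) * cP D * d ^+ 2 * wgt D i =
  (1 + nu^-1) * (cP D * d ^+ 2 * wgt D i) by ring.
rewrite ler_wpM2l //; apply: le_trans (W_le_cP _) _.
rewrite ler_wpM2r ?(ltW (wgt_gt0 i)) // ler_wpM2l ?cP_ge0 //.
by rewrite ler_sqr ?nnegrE ?enorm_ge0 // (le_trans (enorm_ge0 _) (ed i)).
Qed.

End DesignFacts.

(** * Error propagation, recursive feasibility and the estimates over one horizon *)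

Section RunFacts.
Variables (R : realType) (S : network R) (D : design S) (z : run D).
Notation I := 'I_(nsub S).
Notation M := (hor D).
Notation x := (traj z).
Hypothesis cl : closed_loop z.
Hypothesis M_ge2 : (2 <= M)%N.

Lemma M_gt0 : (0 < M)%N. Proof. exact: ltn_trans M_ge2. Qed.

Lemma sub_trajS t (i : I) :
  sub (x t.+1) i = locstep (sub (x t) i) (fun j => sub (x t) j) + Bloc i *m ustar z t i 0%N.
Proof.
have [dyn _ _ _ _] := cl; rewrite dyn [LHS]submxcolD.
by rewrite -[submxcol (Amx S *m _) i]/(sub _ i) sub_mulA
  -[submxcol _ i]/(sub _ i) sub_mulB /subu /uapp mxcolK.
Qed.

Lemma xbar0 t (j : I) : xbar z t j 0%N = sub (x t) j.
Proof. by case: t. Qed.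

Lemma sub_trajS_xnoms t (i : I) : sub (x t.+1) i = xnoms z t i 1.
Proof.
rewrite sub_trajS /xnoms /=; congr (_ + _).
by rewrite /locstep; congr (_ + _); apply: eq_bigr => j _; rewrite xbar0.
Qed.

Lemma dbar_ge0 t (i : I) l : (l < M)%N -> 0 <= dbar z t i l.
Proof.
move=> lM; have [_ _ _ di dt] := cl; rewrite /dbar; case: ifP => // lM'.
by case: t => [|t]; [exact: di | rewrite mulr_ge0 ?Lip2_ge0 ?nbrnorm_ge0].
Qed.

Lemma budget_ge0 t (i : I) l : (l < M)%N -> 0 <= budget z t i l.
Proof.
move=> lM; rewrite /budget /budget_of addr_ge0 ?dbar_ge0 //.
by rewrite mulr_ge0 ?Lip2_ge0 //; exact: bigmax_ge_id.
Qed.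

(** Below the last index this is the radius constraint of the local problem; at [l = M - 1] it is an
    equality, by the convention for the radius at [M]. *)
Lemma rfull_step t (i : I) l : ocp_constraints z t (ustar z t i) (rstar z t i) ->
  (l < M)%N -> Lip1 i * rfull z t i l + budget z t i l <= rfull z t i l.+1.
Proof.
move=> [_ _ rec _] lM; rewrite /rfull /rstar_of /=.
have [lM'|Ml] := ltnP l.+1 M; first by have := rec l lM'; rewrite lM.
have lE : l.+1 = M by apply/eqP; rewrite eqn_leq lM Ml.
(* Because [M >= 2], the index [M - 1] is positive, so the radius there is the optimizer [rstar] and
   not the convention at zero. *)
have l0 : l != 0%N by rewrite -lt0n -ltnS lE.
by rewrite (negPf l0) lM -[in X in X.-1]lE.
Qed.

(** Induction on [l]: [eta] dominates the part of the one-step disturbance exceeding the budget, so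
    the budget is absorbed by the next radius and the excess by the next [smis]. *)
Lemma nominal_error t (i : I) l : ocp_constraints z t (ustar z t i) (rstar z t i) ->
  (l <= M)%N ->
  enorm (sub (x (t + l)%N) i - xnoms z t i l) <= rfull z t i l + smis z t i l.
Proof.
move=> oc; elim: l => [|l IHl] lM; first by rewrite addn0 subrr enorm0 /rfull /rstar_of /= addr0.
rewrite addnS sub_trajS /xnoms /= -/(xnoms z t i l) opprD addrACA -mulmxBr.
apply: le_trans (enormD _ _) _.
have h1 := enorm_locstepB (sub (x (t + l)%N) i) (xnoms z t i l)
  (fun j => sub (x (t + l)%N) j) (fun j => xbar z t j l).
have h2 := enorm_mulmx (Bloc i) (ustar z (t + l) i 0%N - ustar z t i l).
have h3 := ler_wpM2l (opnorm_ge0 (Ablk i i)) (IHl (ltnW lM)).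
have h4 := rfull_step oc lM.
have h5 : Lip2 i * pmis z t i l + Lip3 i * deltau z t i l - budget z t i l <= eta z t i l.
  by rewrite /eta le_max lexx.
rewrite -/(pmis z t i l) -/(Lip3 i) -/(deltau z t i l) -/(Lip1 i) in h1 h2 h3 *.
lra.
Qed.

(** Both trajectories start at the same state and use the same shifted inputs, so the input terms
    cancel and only the change of the packets drives the distance. *)
Lemma xtil_chi t (i : I) l : enorm (xtil z t i l - xnoms z t i l.+1) <= chi z t i l.
Proof.
elim: l => [|l IHl]; first by rewrite /xtil /= sub_trajS_xnoms subrr enorm0.
rewrite /xtil /= -/(xtil z t i l) /xnoms [nomtraj _ _ _ l.+2]/= -/(xnoms z t i l.+1).
rewrite opprD addrACA subrr addr0; apply: le_trans (enorm_locstepB _ _ _ _) _.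
by rewrite lerD2r ler_wpM2l // opnorm_ge0.
Qed.

Lemma rtil_ge0 t (i : I) l : (l <= M)%N -> 0 <= rtil z t i l.
Proof.
elim: l => //= l IHl lM.
by rewrite addr_ge0 ?budget_ge0 // mulr_ge0 ?opnorm_ge0 // IHl // ltnW.
Qed.

Lemma nomtraj_ext (i : I) x0 (y : forall j : I, nat -> 'cV[R]_(xdim j)) u u' l :
  (forall k, (k < l)%N -> u k = u' k) ->
  nomtraj (i := i) x0 y u l = nomtraj x0 y u' l.
Proof.
elim: l => //= l IHl uu'; rewrite uu' ?ltnSn // IHl // => k kl.
by rewrite uu' // ltnS ltnW.
Qed.

(** Write [y + e] as [y'] plus a vector of norm at most [c + r]; by Cauchy-Schwarz it changes row
    [k] by at most the row norm times [c + r]. *)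
Lemma tightened_polyhedron m n (F : 'M[R]_(m, n)) (f : 'cV[R]_m) (y y' : 'cV[R]_n) (c r : R) :
  enorm (y - y') <= c ->
  (forall k, (F *m y') k 0 + enorm (row k F)^T * (c + r) <= f k 0) ->
  pdiff (polyhedron F f) (@cball R n r) y.
Proof.
move=> yc Ff e /= er k; apply: le_trans (Ff k).
have -> : y + e = y' + ((y - y') + e) by rewrite addrA (addrC y') subrK.
rewrite mulmxDr mxE lerD2l; set v := _ + e.
have -> : (F *m v) k 0 = ((row k F)^T^T *m v) 0 0 by rewrite trmxK -row_mul [RHS]mxE.
apply: le_trans (dot_le_enorm _ _) _; rewrite ler_wpM2l ?enorm_ge0 //.
by apply: le_trans (enormD _ _) _; rewrite lerD.
Qed.

Hypothesis Ppd : forall i, posdef (Pmx D i).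

Lemma feasibleS t (i : I) : ocp_constraints z t (ustar z t i) (rstar z t i) ->
  transition_ok z t i -> ocp_feasible z t.+1 i.
Proof.
move=> [uU _ _ _] [Ftight [v vU Wv]].
(* The previous optimal inputs shifted by one, with [v] appended at [l = M - 1]. The radii are
   [rtil], which satisfy their recursion with equality. *)
pose u l := if (l.+1 < M)%N then ustar z t i l.+1 else v.
have nomE l : (l < M)%N ->
    nomtraj (sub (x t.+1) i) (xbar z t.+1) u l = xtil z t i l.
  move=> lM; apply: nomtraj_ext => k kl; rewrite /u ifT //.
  exact: leq_ltn_trans lM.
exists u, (rtil z t i); split.
- by move=> l lM; rewrite /u; case: ifP => // lM'; exact: uU.
- move=> l /andP[l0 lM]; split; first exact/rtil_ge0/ltnW.
  rewrite nomE //; apply: tightened_polyhedron (xtil_chi t i l) _ => k.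
  by apply: Ftight; rewrite l0.
- move=> l lM /=; suff -> : (if l == 0%N then 0 else rtil z t i l) = rtil z t i l by [].
  by case: l lM.
(* The last nominal step uses [v], so squaring its norm condition gives the terminal constraint. *)
- rewrite /W qform_sqrtmx // -[leRHS]sqr_sqrtr ?maxgain_ge0 //.
  rewrite ler_sqr ?nnegrE ?enorm_ge0 ?sqrtr_ge0 //.
  rewrite -(prednK M_gt0) /= nomE; last by rewrite prednK ?M_gt0.
  by rewrite {1}/u prednK ?M_gt0 // ltnn.
Qed.

Hypothesis x0X : Xset (x 0%N).
Hypothesis rc : recursive_conditions z.

Lemma star_constraints t (i : I) : ocp_feasible z t i ->
  ocp_constraints z t (ustar z t i) (rstar z t i).
Proof. by have [_ opt _ _ _] := cl; move=> /opt[]. Qed.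

Lemma feasible t (i : I) : ocp_feasible z t i.
Proof.
have [f0 tr] := rc; elim: t i => [|t IHt] i; first exact: f0.
by apply: feasibleS; [exact/star_constraints/IHt | exact: tr].
Qed.

Lemma run_constraints t (i : I) : ocp_constraints z t (ustar z t i) (rstar z t i).
Proof. exact/star_constraints/feasible. Qed.

Lemma uapp_Uset t : Uset (uapp z t).
Proof.
move=> i; rewrite /subu /uapp mxcolK.
by have [uU _ _ _] := run_constraints t i; exact: uU M_gt0.
Qed.

(** A successor state is the nominal state at [l = 1]. As [1 < M] it obeys a tightened constraint,
    and the zero error lies in the ball since the radius is nonnegative. *)
Lemma traj_Xset t : Xset (x t).
Proof.
case: t => // t i; rewrite sub_trajS_xnoms.
have [_ rX _ _] := run_constraints t i; have [r0 X1] := rX 1%N M_ge2.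
by rewrite -[xnoms _ _ _ _]addr0; apply: X1; rewrite /cball /= enorm0.
Qed.

Lemma JstarE t (i : I) : Jstar z t i = ocp_cost z t (ustar z t i) (rstar z t i).
Proof.
have [_ opt _ _ _] := cl; have [oc omin] := opt t i (feasible t i).
apply: le_anti; apply/andP; split.
  apply: ge_inf; last by exists (ustar z t i), (rstar z t i).
  by exists (ocp_cost z t (ustar z t i) (rstar z t i)) => _ [u [r [/omin le ->]]].
apply: lb_le_inf; first by eexists; exists (ustar z t i), (rstar z t i).
by move=> _ [u [r [/omin le ->]]].
Qed.

Hypothesis lam_gt0 : 0 < lam D.

Lemma W_xnoms_le_Jstar t (i : I) l : (l < M)%N -> W D (xnoms z t i l) <= Jstar z t i.
Proof.
move=> lM; rewrite JstarE /ocp_cost -[leLHS]addr0 lerD //.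
  rewrite big_mkord (bigD1 (Ordinal lM)) //= lerDl.
  by apply: sumr_ge0 => k _; exact: W_ge0.
rewrite mulr_ge0 ?(ltW lam_gt0) // big_nat; apply: sumr_ge0 => k kM.
by have [_ rX _ _] := run_constraints t i; have [] := rX k kM.
Qed.

Hypothesis wgt_gt0 : forall i, 0 < wgt D i.

Lemma deltaJL_ge0 t : 0 <= deltaJL z t.
Proof. exact: bigmax_ge_id. Qed.

(** [deltaJL] bounds the excess of the optimal cost over [cqi D i * enorm (x t) ^+ 2]; the latter is
    converted to [V] through [cq] and [cV]. *)
Lemma Jstar_le t (i : I) :
  Jstar z t i <= (cq D / cV D * V D (x t) + deltaJL z t) * wgt D i.
Proof.
have hd : Jstar z t i - cqi D i * enorm (x t) ^+ 2 <= deltaJL z t * wgt D i.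
  rewrite -ler_pdivrMr // mulrC.
  apply: le_trans (le_bigmax _ (fun i => (wgt D i)^-1 *
           Num.max (Jstar z t i - cqi D i * enorm (x t) ^+ 2) 0) i).
  by rewrite ler_wpM2l ?invr_ge0 ?(ltW (wgt_gt0 i)) // le_max lexx.
have hc : cqi D i * enorm (x t) ^+ 2 <= cq D / cV D * V D (x t) * wgt D i.
  apply: le_trans (_ : cq D * wgt D i * enorm (x t) ^+ 2 <= _).
    rewrite ler_wpM2r ?sqr_ge0 // -ler_pdivrMr //.
    exact: (le_bigmax _ (fun i => cqi D i / wgt D i)).
  have := sqr_enorm_le_V Ppd wgt_gt0 (x t) => hV.
  apply: le_trans (ler_wpM2l _ hV) _; first by rewrite mulr_ge0 ?cq_ge0 // ltW.
  by rewrite le_eqVlt; apply/orP; left; apply/eqP; ring.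
lra.
Qed.

Lemma nominal_decomposition t (l : nat) (i : I) :
  sub (x (t + l)%N) i = xnoms z t i l + (sub (x (t + l)%N) i - xnoms z t i l).
Proof. by rewrite addrC subrK. Qed.

Lemma V_intermediate nu t r : 0 < nu -> (r < M)%N ->
  V D (x (t + r)%N) <= kappaL D nu * V D (x t) + DeltaL z nu t.
Proof.
move=> nu0 rM.
(* Multiplying this nominal level by [1 + nu] produces the [kappaL] term and the cost part of
   [DeltaL]; the error radius [epsL] supplies the rest. *)
have c0 : 0 <= cq D / cV D * V D (x t) + deltaJL z t.
  by rewrite addr_ge0 ?deltaJL_ge0 // mulr_ge0 ?V_ge0 // divr_ge0 ?cq_ge0 ?(ltW (cV_gt0 _ _)).
have := V_perturb_le Ppd wgt_gt0 nu0 c0 (nominal_decomposition t r) _ _ (d := epsL z t).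
move=> /(_ (fun i => le_trans (W_xnoms_le_Jstar t i rM) (Jstar_le t i))) h.
apply: le_trans (h _) _ => [i|]; last first.
  by rewrite le_eqVlt; apply/orP; left; apply/eqP; rewrite /kappaL /DeltaL; ring.
apply: le_trans (nominal_error (run_constraints t i) (ltnW rM)) _.
apply: le_trans (le_bigmax _ (fun r : 'I_M => \rmax_i (rfull z t i r + smis z t i r)) (Ordinal rM)).
exact: (le_bigmax _ (fun i => rfull z t i r + smis z t i r)).
Qed.

Lemma rho_ge0 t : 0 <= rho z t.
Proof. exact: bigmax_ge_id. Qed.

Lemma V_M_step theta nu t : certificate D theta -> 0 < nu ->
  V D (x (t + M)%N) <= aL theta nu * V D (x t) + bL D nu * rho z t ^+ 2.
Proof.
move=> cert nu0; have [_ _ _ _ [_ /andP[/ltW th0 _] _]] := cert.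
(* The nominal level at step [M], from the terminal constraint and the weighted gain condition. *)
have c0 : 0 <= theta * V D (x t) by rewrite mulr_ge0 ?V_ge0.
rewrite /aL /bL -mulrA.
apply: (V_perturb_le Ppd wgt_gt0 nu0 c0 (nominal_decomposition t M)) => i.
  have [_ _ _ term] := run_constraints t i.
  by apply: le_trans term _; exact: maxgain_le.
apply: le_trans (nominal_error (run_constraints t i) (leqnn _)) _.
exact: (le_bigmax _ (fun i => rfull z t i M + smis z t i M)).
Qed.

End RunFacts.

(** * Finite-step contractions and comparison functions *)

Section FiniteStepContraction.
Variables (R : realType) (M : nat) (a : R).
Hypothesis a_ge0 : 0 <= a.

Lemma finite_step_iter (v w : nat -> R) (c : R) r k :
  (forall t, v (t + M)%N <= a * v t + w t) -> v r <= c ->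
  v (r + k * M)%N <= a ^+ k * c + \sum_(0 <= q < k) a ^+ (k - 1 - q) * w (r + q * M)%N.
Proof.
move=> step vr; elim: k => [|k IHk]; first by rewrite big_geq // addn0 expr0 mul1r addr0.
have -> : (r + k.+1 * M = r + k * M + M)%N by rewrite mulSn addnCA addnC.
apply: le_trans (step _) _; rewrite big_nat_recr //= subn1 /= subnn expr0 mul1r addrA lerD2r.
apply: le_trans (ler_wpM2l a_ge0 IHk) _; rewrite mulrDr mulrA -exprS lerD2l mulr_sumr.
(* The exponents agree only for [q < k], the subtraction being truncated, so the summation range
   must be kept. *)
rewrite le_eqVlt; apply/orP; left; apply/eqP; apply: eq_big_nat => q /andP[_ qk].
by rewrite mulrA -exprS subn1 -subSn ?prednK //; case: (k) qk.
Qed.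

Lemma exp_eventually_le (c e : R) : a < 1 -> 0 < e ->
  exists k0, forall k, (k0 <= k)%N -> a ^+ k * c <= e.
Proof.
move=> a_lt1 e_gt0.
have a1 : `|a| < 1 by rewrite ger0_norm.
have /cvgr0_norm_lt/(_ _ e_gt0)[k0 _ hk0] := cvg_geometric c a1.
exists k0 => k kk; have := hk0 k kk; rewrite /= mulrC => /ltW.
exact/le_trans/ler_norm.
Qed.

(** Subtracting the fixed point [c / (1 - a)] makes the recursion homogeneous, and [C] bounds its
    first [M] values. The starting time [T] permits bounds that hold only eventually, as needed when
    [rho] tends to zero. *)
Lemma finite_step_eventually (v : nat -> R) (c : R) T :
  a < 1 -> (0 < M)%N ->
  (forall t, (T <= t)%N -> v (t + M)%N <= a * v t + c) ->
  forall e, 0 < e -> exists N, forall t, (N <= t)%N -> v t <= c / (1 - a) + e.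
Proof.
move=> a_lt1 M_gt0 step e e_gt0.
have a1 : 1 - a != 0 by rewrite subr_eq0 gt_eqF.
pose y t := v (T + t)%N - c / (1 - a).
have ystep t : y (t + M)%N <= a * y t + 0.
  have := step (T + t)%N (leq_addr _ _); rewrite /y addnA.
  have -> : a * v (T + t)%N + c = a * (v (T + t)%N - c / (1 - a)) + c / (1 - a).
    by field.
  by rewrite addr0 lerBlDr.
pose C := \big[Num.max/0]_(r < M) y r.
have [k0 hk0] := exp_eventually_le C a_lt1 e_gt0.
exists (T + k0 * M)%N => t tN; rewrite -lerBlDl.
have tT : (T <= t)%N := leq_trans (leq_addr _ _) tN.
have rM : ((t - T) %% M < M)%N by rewrite ltn_mod.
have := @finite_step_iter y (fun=> 0) C ((t - T) %% M) ((t - T) %/ M) ystep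
  (le_bigmax _ (fun r : 'I_M => y r) (Ordinal rM)).
rewrite big1 => [|q _]; last by rewrite mulr0.
rewrite addr0 addnC -divn_eq {1}/y subnKC // => /le_trans; apply; apply: hk0.
by rewrite leq_divRL // leq_subRL.
Qed.

End FiniteStepContraction.

(** The limit superior is an infimum over neighborhoods of infinity, and the tail from [N] is one of
    them. *)
Lemma limn_esup_EFin_le (R : realType) (u : nat -> R) (c : R) :
  (forall e, 0 < e -> exists N, forall t, (N <= t)%N -> u t <= c + e) ->
  (limn_esup (fun t => (u t)%:E) <= c%:E)%E.
Proof.
move=> uc; apply/lee_addgt0Pr => e /uc[N uN].
apply: ge_ereal_inf; exists (ereal_sup ((fun t => (u t)%:E) @` [set t | (N <= t)%N])).
  by exists [set t | (N <= t)%N] => //; exact: nbhs_infty_ge.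
by apply: ge_ereal_sup => _ [t /= Nt <-]; rewrite -EFinD lee_fin uN.
Qed.

Lemma class_KL_exp (R : realType) (c g : R) : 0 < c -> 0 < g ->
  class_KL (fun s t : R => c * s * expR (- (g * t))).
Proof.
move=> c0 g0; split.
- apply: continuous_subspaceT => z; apply: cvgM.
    by apply: cvgM; [exact: cvg_cst | exact: cvg_fst].
  apply: (@continuous_comp _ _ _ (fun z : R * R => - (g * z.2)) expR); last exact: continuous_expR.
  by apply: cvgN; apply: cvgM; [exact: cvg_cst | exact: cvg_snd].
- by move=> t _; rewrite mulr0 mul0r.
- by move=> t _ s s' _ ss; rewrite ltr_pM2r ?expR_gt0 // ltr_pM2l.
- move=> s s0 t t' _ tt; rewrite ler_wpM2l ?mulr_ge0 ?(ltW c0) //.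
  by rewrite ler_expR lerN2 ler_wpM2l // ltW.
- move=> s _; rewrite -[X in _ --> X](mulr0 (c * s)); apply: cvgM; first exact: cvg_cst.
  have h : g * t @[t --> +oo] --> +oo by apply: gt0_cvgMry.
  exact: cvg_comp h (@cvgr_expR R).
Qed.

(** * From geometric decay per block of [M] steps to exponential decay in time *)

Section KLestimate.
Variables (R : realType) (M : nat) (a : R).
Hypotheses (M_gt0 : (0 < M)%N) (a_gt0 : 0 < a) (a_lt1 : a < 1).

(** Chosen so that [a = expR (- (2 * M%:R * decay_rate))]; the factor 2 anticipates the square root
    when passing from [V] to the norm. *)
Definition decay_rate : R := - ln a / (2 * M%:R).

Lemma decay_rate_gt0 : 0 < decay_rate.
Proof. by rewrite divr_gt0 ?mulr_gt0 ?ltr0n // oppr_gt0 ln_lt0 // a_gt0. Qed.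

(** The quotient [t %/ M] falls short of the real ratio by less than one, which costs the factor
    [a^-1]. *)
Lemma exp_divn_le t : a ^+ (t %/ M) <= a^-1 * expR (- (decay_rate * t%:R)) ^+ 2.
Proof.
have MR : 0 < M%:R :> R by rewrite ltr0n.
rewrite -(ler_pM2l a_gt0) mulrA divff ?gt_eqF // mul1r -exprS.
rewrite -{1}(lnK (a_gt0 : a \is Num.pos)) -!expRM_natl ler_expR.
have -> : 2%:R * - (decay_rate * t%:R) = (t%:R / M%:R) * ln a.
  by rewrite /decay_rate; field; rewrite gt_eqF.
rewrite ler_wnM2r ?ln_le0 ?(ltW a_lt1) // ler_pdivrMr // -natrM ler_nat.
by rewrite ltnW // ltn_ceil.
Qed.

End KLestimate.

(** * Closed-loop estimates *)

Section Stability.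
Variables (R : realType) (S : network R) (D : design S).
Variables (theta nu_int nu_M : R).
Hypotheses (lam_gt0 : 0 < lam D) (cert : certificate D theta).
Hypotheses (nu_int_gt0 : 0 < nu_int) (nu_M_gt0 : 0 < nu_M).
Hypothesis a_lt1 : aL theta nu_M < 1.
Notation M := (hor D).
Notation a := (aL theta nu_M).
Notation b := (bL D nu_M).
Notation kL := (kappaL D nu_int).

Let Ppd i : posdef (Pmx D i). Proof. by case: cert. Qed.
Let M_ge2 : (2 <= M)%N. Proof. by case: cert. Qed.
Let wgt_gt0 i : 0 < wgt D i. Proof. by case: cert => _ _ _ _ []. Qed.
Let cV_pos : 0 < cV D := cV_gt0 Ppd wgt_gt0.

Lemma aL_gt0 : 0 < a.
Proof.
have [_ _ _ _ [_ /andP[th0 _] _]] := cert.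
by rewrite mulr_gt0 // addr_gt0.
Qed.

Lemma bL_ge0 : 0 <= b.
Proof. by rewrite mulr_ge0 ?cP_ge0 // addr_ge0 // invr_ge0 ltW. Qed.

(** The added 1 makes the coefficient positive, hence the comparison function strictly increasing,
    and replaces a square root: with [C] the coefficient, [C - 1 <= C ^+ 2]. *)
Lemma decay_coef_gt0 d : 0 <= d -> 0 < (kL + d) * cP D / (cV D * a) + 1.
Proof.
move=> d0; have k0 : 0 <= kL + d by rewrite addr_ge0 // kappaL_ge0.
rewrite ltr_wpDl // divr_ge0 //; first exact: mulr_ge0 (cP_ge0 D).
by rewrite mulr_ge0 ?(ltW cV_pos) ?(ltW aL_gt0).
Qed.

Section OneRun.
Variable z : run D.
Hypothesis hz : run_hyps z.
Notation x := (traj z).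

Let cl : closed_loop z. Proof. by case: hz. Qed.
Let rc : recursive_conditions z. Proof. by case: hz. Qed.

Lemma V_M_step_run t : V D (x (t + M)%N) <= a * V D (x t) + b * rho z t ^+ 2.
Proof. exact: V_M_step. Qed.

Lemma V_iterate r k : (r < M)%N ->
  V D (x (r + k * M)%N) <= a ^+ k * (kL * V D (x 0%N) + DeltaL z nu_int 0) +
    b * \sum_(0 <= q < k) a ^+ (k - 1 - q) * rho z (r + q * M)%N ^+ 2.
Proof.
move=> rM; rewrite mulr_sumr; under eq_bigr do rewrite mulrCA.
apply: (@finite_step_iter _ M a _ (fun t => V D (x t)) (fun t => b * rho z t ^+ 2)).
- exact/ltW/aL_gt0.
- exact: V_M_step_run.
- by have := V_intermediate cl M_ge2 Ppd rc lam_gt0 wgt_gt0 0 nu_int_gt0 rM; rewrite add0n.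
Qed.

Lemma enorm_eventually (L : R) : 0 <= L ->
  (forall e, 0 < e -> exists N, forall t, (N <= t)%N -> V D (x t) <= L + e) ->
  forall e, 0 < e -> exists N, forall t, (N <= t)%N ->
    enorm (x t) <= Num.sqrt (L / cV D) + e.
Proof.
(* The slack [cV D * e ^+ 2] works because [L / cV D + e ^+ 2] is at most the square of the claimed
   bound. *)
move=> L0 VL e e_gt0; have [|N VN] := VL (cV D * e ^+ 2).
  by rewrite mulr_gt0 // exprn_gt0.
exists N => t /VN Vt; have s0 := sqrtr_ge0 (L / cV D).
rewrite -ler_sqr ?nnegrE ?enorm_ge0 ?addr_ge0 ?(ltW e_gt0) //.
apply: le_trans (sqr_enorm_le_V Ppd wgt_gt0 _) _.
apply: le_trans (_ : L / cV D + e ^+ 2 <= _).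
  by rewrite ler_pdivrMr // mulrDl divfK ?gt_eqF // [e ^+ 2 * _]mulrC.
rewrite sqrrD sqr_sqrtr ?divr_ge0 ?(ltW cV_pos) // -addrA lerD2l lerDr.
by rewrite mulrn_wge0 // mulr_ge0 // ltW.
Qed.

Lemma V_eventually (rb : R) T : (forall t, (T <= t)%N -> rho z t <= rb) ->
  forall e, 0 < e -> exists N, forall t, (N <= t)%N ->
    V D (x t) <= b / (1 - a) * rb ^+ 2 + e.
Proof.
move=> rho_le; rewrite mulrAC; apply: (@finite_step_eventually _ M a _ (fun t => V D (x t)) _ T)
  => //.
- exact/ltW/aL_gt0.
- exact: ltnW.
move=> t /rho_le le_rb; apply: le_trans (V_M_step_run t) _.
rewrite lerD2l ler_wpM2l ?bL_ge0 // ler_sqr ?nnegrE ?rho_ge0 //.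
exact: le_trans (rho_ge0 _ _) le_rb.
Qed.

Lemma enorm_eventually_rho (rb : R) T : (forall t, (T <= t)%N -> rho z t <= rb) ->
  forall e, 0 < e -> exists N, forall t, (N <= t)%N ->
    enorm (x t) <= Num.sqrt (b / (cV D * (1 - a))) * rb + e.
Proof.
move=> rho_le; have rb0 : 0 <= rb := le_trans (rho_ge0 _ _) (rho_le T (leqnn T)).
have a1 : 0 < 1 - a by rewrite subr_gt0.
have q0 : 0 <= b / (1 - a) by rewrite divr_ge0 ?bL_ge0 // ltW.
have -> : Num.sqrt (b / (cV D * (1 - a))) * rb =
    Num.sqrt (b / (1 - a) * rb ^+ 2 / cV D).
  rewrite -{1}(ger0_norm rb0) -sqrtr_sqr -sqrtrM; last first.
    by rewrite divr_ge0 ?bL_ge0 // mulr_ge0 ?(ltW cV_pos) // ltW.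
  congr Num.sqrt; field; rewrite !gt_eqF //.
apply: enorm_eventually; first by rewrite mulr_ge0 ?sqr_ge0.
exact: V_eventually rho_le.
Qed.

Lemma traj_cvg0 : rho z t @[t --> \oo] --> (0 : R) ->
  enorm (x t) @[t --> \oo] --> (0 : R).
Proof.
move=> /cvgr0_norm_lt rho0; apply/cvgr0Pnorm_lt => e e_gt0.
(* The added 1 allows division by [s]. Once [rho] is below [e / 3 / s], the eventual bound is at
   most [e / 3 + e / 3 < e]. *)
pose s := Num.sqrt (b / (cV D * (1 - a))) + 1.
have s_gt0 : 0 < s by rewrite ltr_wpDl ?sqrtr_ge0.
have e3 : 0 < e / 3 by rewrite divr_gt0.
have [T _ hT] := rho0 (e / 3 / s) (divr_gt0 e3 s_gt0).
have [|N hN] := @enorm_eventually_rho (e / 3 / s) T _ (e / 3) e3.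
  by move=> t /hT /ltW; apply: le_trans; exact: ler_norm.
exists N => // t /= /hN xt; rewrite ger0_norm ?enorm_ge0 //.
apply: le_lt_trans xt _.
apply: le_lt_trans (_ : s * (e / 3 / s) + e / 3 < _).
  by rewrite lerD2r ler_wpM2r ?lerDl // divr_ge0 // ltW.
by rewrite mulrC divfK ?gt_eqF //; lra.
Qed.

Lemma limsup_bounds rb : (forall t, rho z t <= rb) ->
  (limn_esup (fun t => (V D (x t))%:E) <= (b / (1 - a) * rb ^+ 2)%:E)%E /\
  (limn_esup (fun t => (enorm (x t))%:E) <=
     (Num.sqrt (b / (cV D * (1 - a))) * rb)%:E)%E.
Proof.
move=> rho_le; split; apply: limn_esup_EFin_le.
- exact: (@V_eventually rb 0).
- exact: (@enorm_eventually_rho rb 0).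
Qed.

Variable d : R.
Hypothesis d_ge0 : 0 <= d.
Hypothesis rho0 : forall t, rho z t = 0.
Hypothesis Delta_le : DeltaL z nu_int 0 <= d * V D (x 0%N).

Lemma V_geometric r k : (r < M)%N ->
  V D (x (r + k * M)%N) <= a ^+ k * (kL + d) * V D (x 0%N).
Proof.
move=> rM; apply: le_trans (V_iterate k rM) _.
rewrite big1 => [|q _]; last by rewrite rho0 expr0n mulr0.
by rewrite mulr0 addr0 -mulrA ler_wpM2l ?exprn_ge0 ?(ltW aL_gt0) // mulrDl lerD2l.
Qed.

Lemma enorm_exp_le t :
  enorm (x t) <= ((kL + d) * cP D / (cV D * a) + 1) * enorm (x 0%N) *
    expR (- (decay_rate M a * t%:R)).
Proof.
set C := _ + 1; set E := expR _.
have C_gt0 : 0 < C := decay_coef_gt0 d_ge0.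
have E0 : 0 <= E := expR_ge0 _.
rewrite -ler_sqr ?nnegrE ?mulr_ge0 ?enorm_ge0 ?(ltW C_gt0) //.
apply: le_trans (sqr_enorm_le_V Ppd wgt_gt0 _) _.
have tM : (t %% M < M)%N by rewrite ltn_mod ltnW.
have := V_geometric (t %/ M) tM; rewrite addnC -divn_eq => Vt.
apply: le_trans (_ : (C - 1) * (enorm (x 0%N) * E) ^+ 2 <= _); last first.
  rewrite -[in leRHS]mulrA [leRHS]exprMn ler_wpM2r ?sqr_ge0 //.
  by have := sqr_ge0 C; have := sqr_ge0 (C - 1); lra.
rewrite ler_pdivrMr //; apply: le_trans Vt _.
(* Regrouped so that the exponential bounds the power of [a], and [cP] bounds the initial value of
   [V]. *)
have -> : (C - 1) * (enorm (x 0%N) * E) ^+ 2 * cV D =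
    (a^-1 * E ^+ 2) * (kL + d) * (cP D * enorm (x 0%N) ^+ 2).
  by rewrite /C; field; rewrite !gt_eqF ?aL_gt0.
have k0 : 0 <= kL + d by rewrite addr_ge0 // kappaL_ge0.
apply: ler_pM.
- by rewrite mulr_ge0 // exprn_ge0 // ltW // aL_gt0.
- exact: V_ge0.
- by rewrite ler_wpM2r // exp_divn_le ?aL_gt0 // ltnW.
- exact: V_le_cP.
Qed.

End OneRun.

Lemma asymptotically_stable_runs (C : set (run D)) (d : R) : 0 <= d ->
  (forall z, C z -> run_hyps z) ->
  (forall z, C z -> forall t, rho z t = 0) ->
  (forall z, C z -> DeltaL z nu_int 0 <= d * V D (traj z 0%N)) ->
  asymptotically_stable C (@traj R S D).
Proof.
move=> d0 hyp rho0 dV; split=> [e e_gt0|z Cz]; last first.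
  apply: traj_cvg0 (hyp z Cz) _.
  by under eq_fun do rewrite rho0 //; exact: cvg_cst.
pose c := (kL + d) * cP D / (cV D * a) + 1.
have c_gt0 : 0 < c := decay_coef_gt0 d0.
(* The exponential factor is at most 1, so [c] bounds the overshoot uniformly over the family of
   runs. *)
exists (e / c); first exact: divr_gt0.
move=> z Cz; rewrite ltr_pdivlMr // mulrC => x0 t; apply: le_lt_trans x0.
apply: le_trans (enorm_exp_le (hyp z Cz) d0 (rho0 z Cz) (dV z Cz) t) _.
rewrite -[leRHS]mulr1 ler_wpM2l ?mulr_ge0 ?enorm_ge0 ?(ltW c_gt0) //.
rewrite -expR0 ler_expR oppr_le0 mulr_ge0 // ltW // decay_rate_gt0 ?aL_gt0 //.
exact: ltnW.
Qed.

End Stability.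

Unset Implicit Arguments.

Theorem theorem3 (R : realType) (S : network R) (D : design S)
    (D0 : set (state S)) (theta nu_int nu_M : R) :
  0 < lam D ->
  certificate D theta ->
  admissible D D0 ->
  0 < nu_int ->
  0 < nu_M ->
  aL theta nu_M < 1 ->
  let M := hor D in
  let kL := kappaL D nu_int in
  let a := aL theta nu_M in
  let b := bL D nu_M in
  (forall z : run D, run_hyps z ->
    let x := traj z in
    (* (a) *)
    ((forall t i, ocp_feasible z t i) /\
     (forall t, Xset (x t) /\ Uset (uapp z t))) /\
    (* (b) *)
    (forall t r, (r < M)%N ->
       V D (x (t + r)%N) <= kL * V D (x t) + DeltaL z nu_int t) /\
    (* (c) *)
    (forall t, V D (x (t + M)%N) <= a * V D (x t) + b * rho z t ^+ 2) /\
    (* (d) *)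
    (forall r k, (r < M)%N ->
       V D (x (r + k * M)%N) <=
         a ^+ k * (kL * V D (x 0%N) + DeltaL z nu_int 0) +
         b * \sum_(0 <= q < k) a ^+ (k - 1 - q) * rho z (r + q * M)%N ^+ 2) /\
    (* (e) *)
    (forall rb : R, (forall t, rho z t <= rb) ->
       (limn_esup (fun t => (V D (x t))%:E) <= (b / (1 - a) * rb ^+ 2)%:E)%E /\
       (limn_esup (fun t => (enorm (x t))%:E) <=
          (Num.sqrt (b / (cV D * (1 - a))) * rb)%:E)%E) /\
    (* (f) *)
    (rho z t @[t --> \oo] --> (0 : R) ->
       enorm (x t) @[t --> \oo] --> (0 : R))) /\
  (* (g): C is the closed loop considered, as a family of runs with initial
     states in the domain Dom *)
  (forall (Dom : set (state S)) (C : set (run D)) (d : R),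
     Dom `<=` @Xset R S ->
     (forall z, C z -> run_hyps z /\ Dom (traj z 0%N)) ->
     (forall z, C z -> forall t, rho z t = 0) ->
     0 <= d ->
     (forall z, C z -> DeltaL z nu_int 0 <= d * V D (traj z 0%N)) ->
     asymptotically_stable C (@traj R S D) /\
     (forall z, C z -> forall r k, (r < M)%N ->
        V D (traj z (r + k * M)%N) <= a ^+ k * (kL + d) * V D (traj z 0%N)) /\
     (exists2 be : R -> R -> R, class_KL be &
        forall z, C z -> forall t,
          enorm (traj z t) <= be (enorm (traj z 0%N)) t%:R)).
Proof.
move=> lam_gt0 cert _ nu_int_gt0 nu_M_gt0 a_lt1 M kL a b.
have [Ppd M_ge2 _ _ [wgt_gt0 _ _]] := cert.
split=> [z hz x|Dom C d _ hC rho0 d0 dV].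
  have [cl x0X rc] := hz; split; [split|split; [|split; [|split; [|split]]]].
  - by move=> t i; exact: feasible.
  - by move=> t; split; [exact: traj_Xset | exact: uapp_Uset].
  - by move=> t r; exact: V_intermediate.
  - by move=> t; exact: V_M_step.
  - by move=> r k; exact: V_iterate.
  - exact: limsup_bounds.
  - exact: (traj_cvg0 cert nu_M_gt0 a_lt1 hz).
have hyp z : C z -> run_hyps z by move=> /hC[].
split; first exact: (asymptotically_stable_runs lam_gt0 cert nu_int_gt0 nu_M_gt0 a_lt1 d0).
split=> [z Cz r k|].
  by apply: V_geometric => //; [exact: hyp | exact: rho0 | exact: dV].
(* One comparison function serves the whole family: its constants depend only on the design,
   [theta], [nu_int], [nu_M] and [d]. *)
exists (fun s t => ((kL + d) * cP D / (cV D * a) + 1) * s * expR (- (decay_rate M a * t))).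
  apply: class_KL_exp; last by rewrite decay_rate_gt0 ?(aL_gt0 cert) // ltnW.
  exact: (decay_coef_gt0 cert).
move=> z Cz t; apply: enorm_exp_le => //; [exact: hyp | exact: rho0 | exact: dV].
Qed.
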